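(* The map given on graded elements by $$x_\alpha^\pm\otimes t^r\mapsto x_\alpha^\pm\otimes t^{\mathrm{gr}_J(\pm\alpha+r\delta)},\quad \alpha\in\mathring R^+,$$ (and $h\otimes t^r\mapsto h\otimes t^{\mathrm{gr}_J(r\delta)}$ for $h\in\mathring{\mathfrak h}$) defines a graded isomorphism of Lie algebras $\tilde{\mathfrak p}_J\cong\mathring{\mathfrak g}[t]^\sigma$.
   Context: $\mathring{\mathfrak g}$ is a finite-dimensional complex simple Lie algebra with Cartan subalgebra $\mathring{\mathfrak h}$, simple roots $\alpha_1,\dots,\alpha_n$, positive roots $\mathring R^+$, highest root $\theta$, root vectors $x_\alpha^\pm$ of weight $\pm\alpha$ ($\alpha\in\mathring R^+$) from a Chevalley basis, $x_i^\pm=x_{\alpha_i}^\pm$. $\mathfrak g=\mathring{\mathfrak g}\otimes\mathbb C[t^{\pm1}]\oplus\mathbb Cc\oplus\mathbb Cd$ is the untwisted affine Kac--Moody algebra with index set $I=\{0,\dots,n\}$, $\mathring I=I\setminus\{0\}$, minimal positive imaginary root $\delta$, $\alpha_0=\delta-\theta$, standard Borel subalgebra $\mathfrak b=(\mathring{\mathfrak g}\otimes t\mathbb C[t])\oplus(\mathring{\mathfrak b}\otimes1)\oplus\mathbb Cc\oplus\mathbb Cd$. Fix a proper subset $J\subsetneq I$; $\mathfrak p_J$ is the subalgebra of $\mathfrak g$ generated by $\mathfrak b$ and the root spaces $\mathfrak g_{-\alpha_j}$, $j\in J$. $\tilde{\mathfrak p}_J=(\mathfrak p_J\cap[\mathfrak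 g,\mathfrak g])/\mathbb Cc$, viewed as a subalgebra of $\mathring{\mathfrak g}\otimes\mathbb C[t^{\pm1}]$. For $\alpha=\sum_{i\in I}\mathbf a_i(\alpha)\alpha_i$ put $\mathrm{gr}_J(\alpha)=\sum_{i\notin J}\mathbf a_i(\alpha)$; $\tilde{\mathfrak p}_J$ is $\mathbb Z_+$-graded by giving the weight space of weight $\alpha$ the degree $\mathrm{gr}_J(\alpha)$. Let $m=\mathrm{gr}_J(\delta)$, $\xi$ a primitive $m$-th root of unity, $s_i=1$ if $i\notin J$ and $s_i=0$ if $i\in J$. $\sigma$ is the automorphism of order $m$ of $\mathring{\mathfrak g}$ with $\sigma(x_i^+)=\xi^{s_i}x_i^+$ ($i\in\mathring I$), $\sigma(x_\theta^-)=\xi^{s_0}x_\theta^-$; thus $\sigma(x_\alpha^\pm)=\xi^{\pm\mathrm{gr}_J(\alpha)}x_\alpha^\pm$ and $\sigma$ is the identity on $\mathring{\mathfrak h}$. It is extended to the current algebra $\mathring{\mathfrak g}[t]=\mathring{\mathfrak g}\otimes\mathbb C[t]$ by $\sigma(x\otimes t^r)=\xi^{-r}\sigma(x)\otimes t^r$, and $\mathring{\mathfrak g}[t]^\sigma$ is the fixed-point subalgebra, graded by the degree in $t$. *)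

(* Defs.v *)
From HB Require Import structures.
From mathcomp Require Import all_boot all_order all_algebra.
From mathcomp Require Import finmap all_classical.

Set Implicit Arguments.
Unset Strict Implicit.
Unset Printing Implicit Defensive.

Import Order.TTheory GRing.Theory Num.Theory passmx.

Local Open Scope classical_set_scope.
Local Open Scope ring_scope.

(** * Lie algebras *)

HB.mixin Record Lmodule_isLie (K : fieldType) L of GRing.Lmodule K L := {
  bracket : L -> L -> L;
  bracketPl : forall (a : K) (x y z : L),
    bracket (a *: x + y) z = a *: bracket x z + bracket y z;
  bracketPr : forall (a : K) (x y z : L),
    bracket z (a *: x + y) = a *: bracket z x + bracket z y;
  bracketxx : forall x : L, bracket x x = 0;
  jacobi : forall x y z : L,
    bracket x (bracket y z) + bracket y (bracket z x)
      + bracket z (bracket x y) = 0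
}.

#[short(type="lieAlgType")]
HB.structure Definition LieAlgebra (K : fieldType) :=
  {L of GRing.Lmodule K L & Lmodule_isLie K L}.

#[short(type="finLieAlgType")]
HB.structure Definition FinLieAlgebra (K : fieldType) :=
  {L of Vector K L & Lmodule_isLie K L}.

Notation "⟦ x , y ⟧" := (bracket x y) (at level 0, x, y at level 99,
  format "⟦ x ,  y ⟧") : ring_scope.

Section LieTheory.
Variables (K : fieldType) (L : lieAlgType K).
Implicit Types x y z : L.

Lemma bracket_is_linear x : linear (bracket x).
Proof. by move=> a u v; rewrite bracketPr. Qed.

HB.instance Definition _ x :=
  GRing.isLinear.Build K L L *:%R (bracket x) (bracket_is_linear x).

Definition bracketr y : L -> L := fun x => ⟦x, y⟧.

Lemma bracketr_is_linear y : linear (bracketr y).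
Proof. by move=> a u v; rewrite /bracketr bracketPl. Qed.

HB.instance Definition _ y :=
  GRing.isLinear.Build K L L *:%R (bracketr y) (bracketr_is_linear y).

Lemma bracketC x y : ⟦x, y⟧ = - ⟦y, x⟧.
Proof.
apply/eqP; rewrite -subr_eq0 opprK; apply/eqP.
have := bracketxx (x + y).
rewrite raddfD /= -/(bracketr x (x + y)) -/(bracketr y (x + y)) !raddfD /=.
by rewrite /bracketr !bracketxx add0r addr0 addrC.
Qed.

Lemma bracketDl x y z : ⟦x + y, z⟧ = ⟦x, z⟧ + ⟦y, z⟧.
Proof. exact: (raddfD (bracketr z)). Qed.
Lemma bracketDr x y z : ⟦z, x + y⟧ = ⟦z, x⟧ + ⟦z, y⟧.
Proof. exact: raddfD. Qed.
Lemma bracket0l x : ⟦0, x⟧ = 0.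
Proof. exact: (raddf0 (bracketr x)). Qed.
Lemma bracket0r x : ⟦x, 0⟧ = 0.
Proof. exact: raddf0. Qed.
Lemma bracketZl (a : K) x z : ⟦a *: x, z⟧ = a *: ⟦x, z⟧.
Proof. by rewrite -[a *: x]addr0 bracketPl bracket0l addr0. Qed.
Lemma bracketZr (a : K) x z : ⟦z, a *: x⟧ = a *: ⟦z, x⟧.
Proof. by rewrite -[a *: x]addr0 bracketPr bracket0r addr0. Qed.

End LieTheory.

HB.mixin Record isLieMorphism (K : fieldType) (L L' : lieAlgType K)
    (f : L -> L') := {
  lie_morph : forall x y, f ⟦x, y⟧ = ⟦f x, f y⟧
}.

#[short(type="lieHom")]
HB.structure Definition LieMorphism (K : fieldType) (L L' : lieAlgType K) :=
  {f of @GRing.Linear K L L' *:%R f & isLieMorphism K L L' f}.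

(** ** Subspaces and subalgebras of a possibly infinite-dimensional algebra *)

Definition is_subspace (K : fieldType) (V : lmodType K) (S : set V) : Prop :=
  S 0 /\ forall (a : K) x y, S x -> S y -> S (a *: x + y).

Definition lin_span (K : fieldType) (V : lmodType K) (S : set V) : set V :=
  smallest (@is_subspace K V) S.

Definition is_subalgebra (K : fieldType) (L : lieAlgType K) (S : set L) :
  Prop := is_subspace S /\ forall x y, S x -> S y -> S ⟦x, y⟧.

Record lieSubalg (K : fieldType) (L : lieAlgType K) := LieSubalg {
  lieSubalg_set :> L -> Prop;
  lieSubalgP : is_subalgebra lieSubalg_set
}.

Section SubLie.
Variables (K : fieldType) (L : lieAlgType K) (S : lieSubalg L).

Definition lieSubalg_pred : {pred L} := fun x => `[< lieSubalg_set S x >].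

Lemma lieSubalg_submod : submod_closed lieSubalg_pred.
Proof.
have [[S0 SD] _] := lieSubalgP S.
split=> [|a x y /asboolP Sx /asboolP Sy]; first exact/asboolP.
by apply/asboolP/SD.
Qed.

HB.instance Definition _ :=
  GRing.isSubmodClosed.Build K L lieSubalg_pred lieSubalg_submod.

Record subLie := SubLie {
  subLie_val :> L;
  subLie_valP : subLie_val \in lieSubalg_pred
}.

HB.instance Definition _ := [isSub for subLie_val].
HB.instance Definition _ := [Choice of subLie by <:].
HB.instance Definition _ := [SubChoice_isSubLmodule of subLie by <:].

Lemma subLie_bracketP (u v : subLie) :
  ⟦subLie_val u, subLie_val v⟧ \in lieSubalg_pred.
Proof.
have [_ SL] := lieSubalgP S.
by apply/asboolP/SL; apply/asboolP; [apply: (valP u) | apply: (valP v)].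
Qed.

Definition subLie_bracket (u v : subLie) : subLie :=
  SubLie (subLie_bracketP u v).

Lemma subLie_bracketPl (a : K) (x y z : subLie) :
  subLie_bracket (a *: x + y) z = a *: subLie_bracket x z + subLie_bracket y z.
Proof. by apply: val_inj; rewrite /= bracketPl. Qed.
Lemma subLie_bracketPr (a : K) (x y z : subLie) :
  subLie_bracket z (a *: x + y) = a *: subLie_bracket z x + subLie_bracket z y.
Proof. by apply: val_inj; rewrite /= bracketPr. Qed.
Lemma subLie_bracketxx (x : subLie) : subLie_bracket x x = 0.
Proof. by apply: val_inj; rewrite /= bracketxx. Qed.
Lemma subLie_jacobi (x y z : subLie) :
  subLie_bracket x (subLie_bracket y z) + subLie_bracket y (subLie_bracket z x)
    + subLie_bracket z (subLie_bracket x y) = 0.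
Proof. by apply: val_inj; rewrite /= jacobi. Qed.

HB.instance Definition _ := Lmodule_isLie.Build K subLie
  subLie_bracketPl subLie_bracketPr subLie_bracketxx subLie_jacobi.

End SubLie.

Section Subalgebras.
Variables (K : fieldType) (L : lieAlgType K).

Lemma is_subspace_span (V : lmodType K) (S : set V) :
  is_subspace (lin_span S).
Proof.
split=> [A [[]]//|a x y Sx Sy A AS].
by have [[_ AD] _] := AS; apply: AD; [apply: Sx | apply: Sy].
Qed.

Lemma is_subalgebra_gen (S : set L) :
  is_subalgebra (smallest (@is_subalgebra K L) S).
Proof.
split; first split=> [A [[[]]]//|a x y Sx Sy A AS].
  by have [[[_ AD] _] _] := AS; apply: AD; [apply: Sx | apply: Sy].
move=> x y Sx Sy A AS.
by have [[_ AL] _] := AS; apply: AL; [apply: Sx | apply: Sy].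
Qed.

Definition lie_gen (S : set L) : lieSubalg L :=
  LieSubalg (is_subalgebra_gen S).

Definition brackets : set L := [set z | exists x y, z = ⟦x, y⟧].

Lemma is_subalgebra_derived : is_subalgebra (lin_span brackets).
Proof.
split=> [|x y _ _]; first exact: is_subspace_span.
by apply: sub_gen_smallest; exists x, y.
Qed.

Definition derived : lieSubalg L := LieSubalg is_subalgebra_derived.

End Subalgebras.

(** ** Finite-dimensional Lie algebras *)

Section FinLie.
Variables (K : fieldType) (g : finLieAlgType K).
Implicit Types (U V H : {vspace g}).

Definition is_ideal U := forall x y, y \in U -> ⟦x, y⟧ \in U.

Definition is_simple : Prop :=
  (exists x y : g, ⟦x, y⟧ != 0) /\
  forall U, is_ideal U -> U = 0%VS \/ U = fullv.

Definition bracketv U V : {vspace g} :=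
  <<[seq ⟦u, v⟧ | u <- vbasis U, v <- vbasis V]>>%VS.

Definition is_nilpotent U := exists k : nat, iter k (bracketv U) U = 0%VS.

Definition is_cartan H : Prop :=
  [/\ forall x y, x \in H -> y \in H -> ⟦x, y⟧ \in H,
      is_nilpotent H &
      forall x, (forall h, h \in H -> ⟦x, h⟧ \in H) -> x \in H].

Definition dualv H := 'Hom(subvs_of H, K^o).

Definition root_space H (a : dualv H) : set g :=
  [set x | forall h : subvs_of H, ⟦vsval h, x⟧ = (a h : K) *: x].

Definition is_root H (a : dualv H) : Prop :=
  a != 0 /\ exists2 x, root_space a x & x != 0.

Definition ad (x : g) : 'End(g) := linfun (bracket x).

Definition killing (x y : g) : K :=
  \tr (mxof (vbasis fullv) (vbasis fullv) (ad x \o ad y)%VF).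

Lemma adE x y : ad x y = ⟦x, y⟧.
Proof. by rewrite lfunE. Qed.

Lemma ad_is_linear : linear ad.
Proof.
by move=> a x y; apply/lfunP => z; rewrite add_lfunE scale_lfunE !adE bracketPl.
Qed.

Lemma ad_bracket x y : ad ⟦x, y⟧ = (ad x \o ad y)%VF - (ad y \o ad x)%VF.
Proof.
apply/lfunP => z; rewrite add_lfunE opp_lfunE !comp_lfunE !adE; have := jacobi x y z.
rewrite [⟦z, ⟦x, y⟧⟧]bracketC => /eqP; rewrite subr_eq0 => /eqP <-.
by rewrite (bracketC z x) raddfN.
Qed.

Local Notation tr f :=
  (\tr (mxof (vbasis fullv) (vbasis fullv) (f : 'End(g))%VF)).

Lemma killingPr (a : K) x y z :
  killing x (a *: y + z) = a * killing x y + killing x z.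
Proof.
rewrite /killing ad_is_linear comp_lfunDr -comp_lfunZr.
by rewrite linearP mxtraceD mxtraceZ.
Qed.

Lemma tr_comp (f h : 'End(g)) : tr (f \o h) = tr (h \o f).
Proof.
by rewrite !(mxof_comp (vbasis fullv) _ (vbasisP fullv)) mxtrace_mulC.
Qed.

Lemma killingC x y : killing x y = killing y x.
Proof. exact: tr_comp. Qed.

Lemma killing_invariant x y z : killing ⟦x, y⟧ z = killing x ⟦y, z⟧.
Proof.
rewrite /killing !ad_bracket comp_lfunDl comp_lfunDr comp_lfunNl comp_lfunNr.
rewrite !linearB /= !comp_lfunA; congr (_ - _).
by rewrite -(comp_lfunA (ad y)) [LHS]tr_comp.
Qed.

End FinLie.

(** * The loop algebra [g ⊗ C[t, t^-1]] *)

(** [f : loop V] stands for the Laurent polynomial [\sum_r f r ⊗ t^r]. *)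

Section Loop.
Variables (K : fieldType) (V : lmodType K).

Definition finsupp_pred : {pred int -> V} :=
  fun f => `[< finite_set [set r | f r != 0] >].

Lemma finsupp_submod : submod_closed finsupp_pred.
Proof.
split=> [|a f h /asboolP ff /asboolP fh]; apply/asboolP.
  by rewrite (_ : mkset _ = set0) // -subset0 => r /=; rewrite eqxx.
apply: (@sub_finite_set _ _ ([set r | f r != 0] `|` [set r | h r != 0])).
  move=> r /=; rewrite (_ : (a *: f + h) r = a *: f r + h r) // => fhr.
  have [fr0|] := eqVneq (f r) 0; last by left.
  by right; move: fhr; rewrite fr0 scaler0 add0r.
by rewrite finite_setU.
Qed.

HB.instance Definition _ :=
  GRing.isSubmodClosed.Build K (int -> V) finsupp_pred finsupp_submod.

Record loop := Loop {
  loop_fun :> int -> V;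
  loop_funP : loop_fun \in finsupp_pred
}.

HB.instance Definition _ := [isSub for loop_fun].
HB.instance Definition _ := [Choice of loop by <:].
HB.instance Definition _ := [SubChoice_isSubLmodule of loop by <:].

Implicit Types f h : loop.

Lemma loop_finite f : finite_set [set r | f r != 0].
Proof. exact/asboolP/loop_funP. Qed.

Lemma loopP f h : (forall r, f r = h r) -> f = h.
Proof. by move=> fh; apply: val_inj; apply: funext. Qed.

Lemma loopDE f h r : (f + h) r = f r + h r. Proof. by []. Qed.
Lemma loopZE (a : K) f r : (a *: f) r = a *: f r. Proof. by []. Qed.
Lemma loop0E r : (0 : loop) r = 0. Proof. by []. Qed.

Fact mono_subproof (s : int) (x : V) :
  (fun r : int => if r == s then x else 0) \in finsupp_pred.
Proof.
apply/asboolP; apply: (@sub_finite_set _ _ [set s]) => // r /=.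
by case: (r =P s) => // _; rewrite eqxx.
Qed.

(** [mono s x] is [x ⊗ t^s]. *)
Definition mono (s : int) (x : V) : loop := Loop (mono_subproof s x).

Lemma monoE s x r : mono s x r = if r == s then x else 0.
Proof. by []. Qed.

Lemma mono_is_linear s : linear (mono s).
Proof.
move=> a x y; apply: loopP => r; rewrite loopDE loopZE !monoE.
by case: ifP; rewrite // scaler0 addr0.
Qed.

HB.instance Definition _ s :=
  GRing.isLinear.Build K V loop *:%R (mono s) (mono_is_linear s).

Lemma loop_ind (P : loop -> Prop) :
  P 0 -> (forall f h, P f -> P h -> P (f + h)) ->
  (forall r x, P (mono r x)) -> forall f, P f.
Proof.
move=> P0 PD Pm f; have /finite_seqP[s fs] := loop_finite f.
have -> : f = \sum_(r <- undup s) mono r (f r).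
  apply: loopP => r.
  have -> : (\sum_(i <- undup s) mono i (f i)) r =
            \sum_(i <- undup s) mono i (f i) r.
    by elim/big_rec2: _ => // i y1 y2 _ <-; rewrite loopDE.
  have [rs|rs] := boolP (r \in undup s).
    rewrite (bigD1_seq r) ?undup_uniq // monoE eqxx big1 => [|i ir].
      by rewrite [RHS]addr0.
    by rewrite monoE eq_sym (negPf ir).
  rewrite big1_seq => [|i /andP[_ si]]; last first.
    by rewrite monoE; case: eqP => // ri; rewrite ri si in rs.
  apply/eqP/negPn/negP => fr0.
  have : [set r | f r != 0] r by [].
  by rewrite fs /= => rs'; rewrite mem_undup rs' in rs.
by elim/big_rec: _ => // r h _; apply: PD.
Qed.

End Loop.
Arguments mono : simpl never.

Section FiniteSums.
Variables (K : fieldType) (V : lmodType K).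

Lemma fsum_linear (A : set int) (a : K) (F G : int -> V) :
    finite_set A -> (forall r, ~ A r -> F r = 0) ->
    (forall r, ~ A r -> G r = 0) ->
  \sum_(r \in [set: int]) (a *: F r + G r) =
  a *: (\sum_(r \in [set: int]) F r) + \sum_(r \in [set: int]) G r.
Proof.
move=> finA F0 G0.
have A0 r : r \notin fset_set A -> ~ A r.
  by rewrite in_fset_set // notin_setE.
rewrite !(fsbigTE (fset_set A)) => [|r /A0 Ar|r /A0 Ar|r /A0 Ar].
- by rewrite big_split /= -scaler_sumr.
- exact: G0.
- exact: F0.
- by rewrite F0 // G0 // scaler0 addr0.
Qed.

End FiniteSums.

Section LoopBracket.
Variables (K : fieldType) (g : lieAlgType K).
Implicit Types f h k : loop g.

(** [⟦x ⊗ t^r, y ⊗ t^s⟧ = ⟦x, y⟧ ⊗ t^(r + s)], see [loop_bracket_mono]. *)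
Definition loop_bracket_fun f h : int -> g :=
  fun n => \sum_(r \in [set: int]) ⟦f r, h (n - r)⟧.

Fact loop_bracket_subproof f h : loop_bracket_fun f h \in @finsupp_pred K g.
Proof.
apply/asboolP; apply: (@sub_finite_set _ _
  [set r + s | r in [set r | f r != 0] & s in [set r | h r != 0]]).
  move=> n /= /(fsbigN1 (f := fun n r => ⟦f r, h (n - r)⟧)) [r _ fh].
  exists r; first by apply: contra_neq fh => ->; rewrite bracket0l.
  exists (n - r); first by apply: contra_neq fh => ->; rewrite bracket0r.
  by rewrite addrC subrK.
by apply: finite_image2; apply: loop_finite.
Qed.

Definition loop_bracket f h : loop g := Loop (loop_bracket_subproof f h).

Lemma loop_bracketPl (a : K) f h k :
  loop_bracket (a *: f + h) k = a *: loop_bracket f k + loop_bracket h k.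
Proof.
apply: loopP => n; rewrite loopDE loopZE /= /loop_bracket_fun.
under eq_fsbigr do rewrite loopDE loopZE bracketPl.
apply: (@fsum_linear _ _ ([set r | f r != 0] `|` [set r | h r != 0])).
- by rewrite finite_setU; split; apply: loop_finite.
- by move=> r /not_orP[/negP/negPn/eqP-> _]; rewrite bracket0l.
- by move=> r /not_orP[_ /negP/negPn/eqP->]; rewrite bracket0l.
Qed.

Lemma loop_bracketPr (a : K) f h k :
  loop_bracket k (a *: f + h) = a *: loop_bracket k f + loop_bracket k h.
Proof.
apply: loopP => n; rewrite loopDE loopZE /= /loop_bracket_fun.
under eq_fsbigr do rewrite loopDE loopZE bracketPr.
apply: (@fsum_linear _ _ [set r | k r != 0]); first exact: loop_finite.
  by move=> r /= /negP/negPn/eqP->; rewrite bracket0l.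
by move=> r /= /negP/negPn/eqP->; rewrite bracket0l.
Qed.

Lemma loop_bracketDl f h k :
  loop_bracket (f + h) k = loop_bracket f k + loop_bracket h k.
Proof. by have := loop_bracketPl 1 f h k; rewrite !scale1r. Qed.
Lemma loop_bracketDr f h k :
  loop_bracket k (f + h) = loop_bracket k f + loop_bracket k h.
Proof. by have := loop_bracketPr 1 f h k; rewrite !scale1r. Qed.
Lemma loop_bracket0l k : loop_bracket 0 k = 0.
Proof. by apply: (addrI (loop_bracket 0 k)); rewrite -loop_bracketDl !addr0. Qed.
Lemma loop_bracket0r k : loop_bracket k 0 = 0.
Proof. by apply: (addrI (loop_bracket k 0)); rewrite -loop_bracketDr !addr0. Qed.

Lemma loop_bracket_mono r s (x y : g) :
  loop_bracket (mono r x) (mono s y) = mono (r + s) ⟦x, y⟧.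
Proof.
apply: loopP => n; rewrite /= /loop_bracket_fun (fsbigTE [fset r]%fset).
  rewrite big_seq_fset1 !monoE eqxx subr_eq [s + r]addrC.
  by case: ifP; rewrite // bracket0r.
by move=> i /[!inE] /negPf ir; rewrite monoE ir bracket0l.
Qed.

Lemma loop_bracket_anti f h : loop_bracket f h = - loop_bracket h f.
Proof.
elim/loop_ind: f => [|f1 f2 IH1 IH2|r x].
- by rewrite loop_bracket0l loop_bracket0r oppr0.
- by rewrite loop_bracketDl loop_bracketDr opprD IH1 IH2.
elim/loop_ind: h => [|h1 h2 IH1 IH2|s y].
- by rewrite loop_bracket0l loop_bracket0r oppr0.
- by rewrite loop_bracketDl loop_bracketDr opprD IH1 IH2.
by rewrite !loop_bracket_mono -raddfN -bracketC addrC.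
Qed.

Lemma loop_bracketxx f : loop_bracket f f = 0.
Proof.
elim/loop_ind: f => [|f1 f2 IH1 IH2|r x].
- by rewrite loop_bracket0l.
- rewrite loop_bracketDl !loop_bracketDr IH1 IH2 [loop_bracket f2 f1]loop_bracket_anti.
  by rewrite add0r addr0 subrr.
- by rewrite loop_bracket_mono bracketxx raddf0.
Qed.

Lemma loop_jacobi f h k :
  loop_bracket f (loop_bracket h k) + loop_bracket h (loop_bracket k f)
    + loop_bracket k (loop_bracket f h) = 0.
Proof.
have DD (a b c a' b' c' : loop g) :
    a + b + c = 0 -> a' + b' + c' = 0 -> (a + a') + (b + b') + (c + c') = 0.
  by move=> e e'; rewrite (addrACA a) (addrACA (a + b)) e e' addr0.
elim/loop_ind: f => [|f1 f2 IH1 IH2|r x].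
- by rewrite !(loop_bracket0l, loop_bracket0r) !addr0.
- by rewrite !(loop_bracketDl, loop_bracketDr); apply: DD.
elim/loop_ind: h => [|h1 h2 IH1 IH2|s y].
- by rewrite !(loop_bracket0l, loop_bracket0r) !addr0.
- by rewrite !(loop_bracketDl, loop_bracketDr); apply: DD.
elim/loop_ind: k => [|k1 k2 IH1 IH2|q z].
- by rewrite !(loop_bracket0l, loop_bracket0r) !addr0.
- by rewrite !(loop_bracketDl, loop_bracketDr); apply: DD.
rewrite !loop_bracket_mono.
rewrite (_ : s + (q + r) = r + (s + q)); last by rewrite addrA addrC.
rewrite (_ : q + (r + s) = r + (s + q)); last by rewrite addrC -addrA.
by rewrite -!raddfD /= jacobi raddf0.
Qed.

HB.instance Definition _ := Lmodule_isLie.Build K (loop g)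
  loop_bracketPl loop_bracketPr loop_bracketxx loop_jacobi.

Lemma bracket_mono r s (x y : g) :
  ⟦mono r x, mono s y⟧ = mono (r + s) ⟦x, y⟧ :> loop g.
Proof. exact: loop_bracket_mono. Qed.

End LoopBracket.

(** * Root data and Chevalley bases *)

(** A root is encoded by the row vector [c] of its integer coordinates in the
    simple roots; [rvec c] is the root vector, so that the pair
    [x_alpha^+, x_alpha^-] is [rvec alpha, rvec (- alpha)]. *)
Record cartanDatum (K : fieldType) (g : finLieAlgType K) := CartanDatum {
  csa : {vspace g};
  rank : nat;
  simple_root : 'I_rank -> dualv csa;
  roots : seq 'rV[int]_rank;
  theta : 'rV[int]_rank;
  rvec : 'rV[int]_rank -> g
}.

Section Datum.
Variables (K : fieldType) (g : finLieAlgType K) (D : cartanDatum g).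
Implicit Types a b c : 'rV[int]_(rank D).

Definition root_eval c : dualv (csa D) :=
  \sum_(i < rank D) simple_root i *~ c 0 i.

Definition nonneg_coords n (c : 'rV[int]_n) : bool := [forall i, 0 <= c 0 i].

Definition pos_root c : bool := (c \in roots D) && nonneg_coords c.

Definition simple_coords (i : 'I_(rank D)) : 'rV[int]_(rank D) := delta_mx 0 i.

(** [coroot c] is the coroot of [c] under [is_chevalley_basis] below. *)
Definition coroot c : g := ⟦rvec c, rvec (- c)⟧.

Definition is_root_datum : Prop :=
  [/\ is_cartan (csa D),
      uniq (roots D) /\ (forall c, c \in roots D <-> is_root (root_eval c)),
      [/\ free [seq simple_root i | i <- enum 'I_(rank D)],
          forall i, is_root (@simple_root _ _ D i) &
          forall a : dualv (csa D), is_root a ->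
            exists2 c, a = root_eval c &
                       nonneg_coords c || nonneg_coords (- c)] &
      theta D \in roots D /\
      (forall c, c \in roots D -> nonneg_coords (theta D - c))].

Definition is_chevalley_basis : Prop :=
  [/\ forall c, c \in roots D -> root_space (root_eval c) (rvec c),
      forall c, c \in roots D -> coroot c \in csa D /\
        root_eval c (vsproj (csa D) (coroot c)) = 2%:R,
      forall a b, a \in roots D -> b \in roots D -> a + b != 0 ->
        if a + b \in roots D then
          forall p : nat, b - a *+ p \in roots D ->
            (forall q : nat, (p < q)%N -> b - a *+ q \notin roots D) ->
            ⟦rvec a, rvec b⟧ = rvec (a + b) *+ p.+1 \/
            ⟦rvec a, rvec b⟧ = - (rvec (a + b) *+ p.+1)
        else ⟦rvec a, rvec b⟧ = 0,
      basis_of (csa D) [seq coroot (simple_coords i) | i <- enum 'I_(rank D)] &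
      basis_of fullv
        ([seq coroot (simple_coords i) | i <- enum 'I_(rank D)]
           ++ [seq rvec c | c <- roots D])].

(** The standard Borel subalgebra [csa + n^+]. *)
Definition fin_borel : {vspace g} :=
  (csa D + <<[seq rvec c | c <- roots D & nonneg_coords c]>>)%VS.

(** The invariant form normalized by [(theta, theta) = 2] on the dual of the
    Cartan subalgebra, i.e. [(coroot theta, coroot theta) = 2]. *)
Definition nform (x y : g) : K :=
  2%:R / killing (coroot (theta D)) (coroot (theta D)) * killing x y.

Lemma nformC x y : nform x y = nform y x.
Proof. by rewrite /nform killingC. Qed.

Lemma nformPr (a : K) x y z : nform x (a *: y + z) = a * nform x y + nform x z.
Proof. by rewrite /nform killingPr mulrDr mulrCA. Qed.

Lemma nformPl (a : K) x y z : nform (a *: x + y) z = a * nform x z + nform y z.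
Proof. by rewrite !(nformC _ z) nformPr. Qed.

Lemma nform_invariant x y z : nform ⟦x, y⟧ z = nform x ⟦y, z⟧.
Proof. by rewrite /nform killing_invariant. Qed.

Lemma nform0r x : nform x 0 = 0.
Proof.
by apply: (addrI (nform x 0)); rewrite -[X in X + _]mul1r -nformPr scale1r !addr0.
Qed.

Lemma nform0l x : nform 0 x = 0. Proof. by rewrite nformC nform0r. Qed.

End Datum.

(** * The untwisted affine Kac-Moody algebra *)

Section LoopDerivation.
Variables (K : fieldType) (g : lieAlgType K).
Implicit Types f h : loop g.

Fact tdt_subproof f : (fun r : int => r%:~R *: f r) \in @finsupp_pred K g.
Proof.
apply/asboolP; apply: (sub_finite_set _ (loop_finite f)) => r /=.
by apply: contra_neq => ->; rewrite scaler0.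
Qed.

(** The derivation [t d/dt]. *)
Definition tdt f : loop g := Loop (tdt_subproof f).

Lemma tdt_is_linear : linear tdt.
Proof.
move=> a f h; apply: loopP => r; rewrite loopDE loopZE /= scalerDr !scalerA.
by rewrite mulrC.
Qed.

HB.instance Definition _ :=
  GRing.isLinear.Build K (loop g) (loop g) *:%R tdt tdt_is_linear.

Lemma tdtD f h : tdt (f + h) = tdt f + tdt h. Proof. exact: raddfD. Qed.
Lemma tdt0 : tdt 0 = 0. Proof. exact: raddf0. Qed.

Lemma tdt_mono r (x : g) : tdt (mono r x) = r%:~R *: mono r x.
Proof.
apply: loopP => s; rewrite loopZE -[LHS]/(s%:~R *: mono r x s) !monoE.
by case: eqP => [->|_] //; rewrite !scaler0.
Qed.

Lemma tdt_bracket f h : tdt ⟦f, h⟧ = ⟦tdt f, h⟧ + ⟦f, tdt h⟧.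
Proof.
elim/loop_ind: f => [|f1 f2 IH1 IH2|r x].
- by rewrite !(bracket0l, tdt0) addr0.
- by rewrite !(bracketDl, tdtD) IH1 IH2 addrACA.
elim/loop_ind: h => [|h1 h2 IH1 IH2|s y].
- by rewrite !(bracket0r, tdt0) addr0.
- by rewrite !(bracketDr, tdtD) IH1 IH2 addrACA.
rewrite bracket_mono !tdt_mono bracketZl bracketZr !bracket_mono -scalerDl.
by rewrite -rmorphD.
Qed.

End LoopDerivation.

Section Cocycle.
Variables (K : numFieldType) (g : finLieAlgType K) (D : cartanDatum g).
Implicit Types f h k : loop g.

(** [cocycle (x ⊗ t^r) (y ⊗ t^s) = r * nform D x y] if [r + s = 0], and [0]
    otherwise. *)
Definition cocycle f h : K :=
  \sum_(r \in [set: int]) r%:~R * nform D (f r) (h (- r)).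

Lemma cocyclePl (a : K) f h k :
  cocycle (a *: f + h) k = a * cocycle f k + cocycle h k.
Proof.
rewrite /cocycle.
under eq_fsbigr do rewrite loopDE loopZE nformPl mulrDr mulrCA.
apply: (@fsum_linear K K^o ([set r | f r != 0] `|` [set r | h r != 0])).
- by rewrite finite_setU; split; apply: loop_finite.
- by move=> r /not_orP[/negP/negPn/eqP-> _]; rewrite nform0l mulr0.
- by move=> r /not_orP[_ /negP/negPn/eqP->]; rewrite nform0l mulr0.
Qed.

Lemma cocyclePr (a : K) f h k :
  cocycle k (a *: f + h) = a * cocycle k f + cocycle k h.
Proof.
rewrite /cocycle.
under eq_fsbigr do rewrite loopDE loopZE nformPr mulrDr mulrCA.
apply: (@fsum_linear K K^o [set r | k r != 0]); first exact: loop_finite.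
  by move=> r /= /negP/negPn/eqP->; rewrite nform0l mulr0.
by move=> r /= /negP/negPn/eqP->; rewrite nform0l mulr0.
Qed.

Lemma cocycleDl f h k : cocycle (f + h) k = cocycle f k + cocycle h k.
Proof. by have := cocyclePl 1 f h k; rewrite scale1r mul1r. Qed.
Lemma cocycleDr f h k : cocycle k (f + h) = cocycle k f + cocycle k h.
Proof. by have := cocyclePr 1 f h k; rewrite scale1r mul1r. Qed.
Lemma cocycle0l k : cocycle 0 k = 0.
Proof. by apply: (addrI (cocycle 0 k)); rewrite -cocycleDl !addr0. Qed.
Lemma cocycle0r k : cocycle k 0 = 0.
Proof. by apply: (addrI (cocycle k 0)); rewrite -cocycleDr !addr0. Qed.
Lemma cocycleZl a f k : cocycle (a *: f) k = a * cocycle f k.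
Proof. by rewrite -[a *: f]addr0 cocyclePl cocycle0l addr0. Qed.
Lemma cocycleZr a f k : cocycle k (a *: f) = a * cocycle k f.
Proof. by rewrite -[a *: f]addr0 cocyclePr cocycle0r addr0. Qed.

Lemma cocycle_mono r s (x y : g) :
  cocycle (mono r x) (mono s y) =
  if r + s == 0 then r%:~R * nform D x y else 0.
Proof.
rewrite /cocycle (fsbigTE [fset r]%fset).
  rewrite big_seq_fset1 !monoE eqxx eq_sym -addr_eq0 addrC.
  by case: ifP; rewrite // nform0r mulr0.
by move=> i /[!inE] /negPf ir; rewrite monoE ir nform0l mulr0.
Qed.

Lemma cocycleC f h : cocycle f h = - cocycle h f.
Proof.
elim/loop_ind: f => [|f1 f2 IH1 IH2|r x].
- by rewrite cocycle0l cocycle0r oppr0.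
- by rewrite cocycleDl cocycleDr IH1 IH2 opprD.
elim/loop_ind: h => [|f1 f2 IH1 IH2|s y].
- by rewrite cocycle0l cocycle0r oppr0.
- by rewrite cocycleDl cocycleDr IH1 IH2 opprD.
rewrite !cocycle_mono [s + r]addrC nformC; case: eqP => [|_]; rewrite ?oppr0 //.
by move/eqP; rewrite addr_eq0 => /eqP->; rewrite rmorphN mulNr.
Qed.

Lemma cocyclexx f : cocycle f f = 0.
Proof. by apply/eqP; rewrite -eqNr -cocycleC. Qed.

Lemma cocycle_tdt f h : cocycle (tdt f) h = - cocycle f (tdt h).
Proof.
elim/loop_ind: f => [|f1 f2 IH1 IH2|r x].
- by rewrite tdt0 !cocycle0l oppr0.
- by rewrite tdtD !cocycleDl IH1 IH2 opprD.
elim/loop_ind: h => [|f1 f2 IH1 IH2|s y].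
- by rewrite tdt0 !cocycle0r oppr0.
- by rewrite tdtD !cocycleDr IH1 IH2 opprD.
rewrite !tdt_mono cocycleZl cocycleZr cocycle_mono.
case: eqP => [|_]; rewrite ?mulr0 ?oppr0 //.
by move/eqP; rewrite addr_eq0 => /eqP->; rewrite rmorphN mulNr.
Qed.

Lemma cocycle_jacobi f h k :
  cocycle f ⟦h, k⟧ + cocycle h ⟦k, f⟧ + cocycle k ⟦f, h⟧ = 0.
Proof.
have DD (a b c a' b' c' : K) :
    a + b + c = 0 -> a' + b' + c' = 0 -> (a + a') + (b + b') + (c + c') = 0.
  by move=> e e'; rewrite (addrACA a) (addrACA (a + b)) e e' addr0.
elim/loop_ind: f => [|f1 f2 IH1 IH2|r x].
- by rewrite !(bracket0l, bracket0r, cocycle0l, cocycle0r) !addr0.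
- by rewrite !(bracketDl, bracketDr, cocycleDl, cocycleDr); apply: DD.
elim/loop_ind: h => [|h1 h2 IH1 IH2|s y].
- by rewrite !(bracket0l, bracket0r, cocycle0l, cocycle0r) !addr0.
- by rewrite !(bracketDl, bracketDr, cocycleDl, cocycleDr); apply: DD.
elim/loop_ind: k => [|k1 k2 IH1 IH2|q z].
- by rewrite !(bracket0l, bracket0r, cocycle0l, cocycle0r) !addr0.
- by rewrite !(bracketDl, bracketDr, cocycleDl, cocycleDr); apply: DD.
rewrite !bracket_mono !cocycle_mono.
rewrite (_ : s + (q + r) = r + (s + q)); last by rewrite addrA addrC.
rewrite (_ : q + (r + s) = r + (s + q)); last by rewrite addrC -addrA.
case: eqP => [rsq|_]; last by rewrite !addr0.
rewrite -(nform_invariant D x y z) (nformC D y) (nform_invariant D z).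
rewrite (nformC D z ⟦x, y⟧).
by rewrite -!mulrDl -!rmorphD -addrA rsq mul0r.
Qed.

End Cocycle.

Section Affine.
Variables (K : numFieldType) (g : finLieAlgType K).

(** The triple [(f, z, w)] stands for [f + z c + w d]. *)
Definition affine of cartanDatum g : Type := (loop g * K^o * K^o)%type.

Variable D : cartanDatum g.

HB.instance Definition _ :=
  GRing.Lmodule.copy (affine D) (loop g * K^o * K^o)%type.

Definition affine_bracket (X Y : affine D) : affine D :=
  (⟦X.1.1, Y.1.1⟧ + X.2 *: tdt Y.1.1 - Y.2 *: tdt X.1.1,
   cocycle D X.1.1 Y.1.1, 0).

Lemma affine_bracketxx X : affine_bracket X X = 0.
Proof.
by rewrite /affine_bracket bracketxx cocyclexx add0r subrr.
Qed.

Lemma affine_bracketPl (a : K) (X Y Z : affine D) :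
  affine_bracket (a *: X + Y) Z =
  a *: affine_bracket X Z + affine_bracket Y Z.
Proof.
case: X Y Z => [[f z] w] [[f' z'] w'] [[f'' z''] w''].
congr (_, _, _); rewrite /=; [| exact: cocyclePl | by rewrite scaler0 addr0].
rewrite bracketPl linearP /= !scalerDr !scalerDl !scalerA opprD scalerN.
rewrite scalerA [w'' * a]mulrC; set A := a *: _; set B := (a * w) *: _.
by rewrite [A + _ + _]addrACA [RHS]addrACA.
Qed.

Lemma affine_bracketC X Y : affine_bracket X Y = - affine_bracket Y X.
Proof.
congr (_, _, _); rewrite /= ?oppr0 //; last exact: cocycleC.
by rewrite bracketC !opprD opprK addrAC.
Qed.

Lemma affine_bracketPr (a : K) (X Y Z : affine D) :
  affine_bracket Z (a *: X + Y) =
  a *: affine_bracket Z X + affine_bracket Z Y.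
Proof.
rewrite affine_bracketC affine_bracketPl !(affine_bracketC Z).
by rewrite opprD scalerN.
Qed.

Lemma affine_jacobi X Y Z :
  affine_bracket X (affine_bracket Y Z) + affine_bracket Y (affine_bracket Z X)
    + affine_bracket Z (affine_bracket X Y) = 0.
Proof.
have tele (V : zmodType) (a b c : V) : (a - c) + (b - a) + (c - b) = 0.
  by rewrite [a - c + _]addrC !subrKA subrr.
case: X Y Z => [[f1 z1] w1] [[f2 z2] w2] [[f3 z3] w3].
congr (_, _, _); rewrite /= ?addr0 //.
- pose b (f h : loop g) := ⟦f, tdt h⟧.
  have expand (f f' f'' : loop g) (w w' w'' : K) :
      ⟦f, ⟦f', f''⟧ + w' *: tdt f'' - w'' *: tdt f'⟧
        + w *: tdt (⟦f', f''⟧ + w' *: tdt f'' - w'' *: tdt f') - 0 *: tdt f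
    = ⟦f, ⟦f', f''⟧⟧ + (w' *: b f f'' - w *: b f'' f')
      + (w *: b f' f'' - w'' *: b f f')
      + ((w * w') *: tdt (tdt f'') - (w'' * w) *: tdt (tdt f')).
    rewrite scale0r subr0 !tdtD !bracketDr !(raddfN, bracketZr) /= !linearZ /=.
    rewrite tdt_bracket !scalerDr scalerN !scalerA [w'' * w]mulrC /b.
    rewrite (bracketC (tdt f')) scalerN.
    set A := ⟦_, ⟦_, _⟧⟧; set B := w' *: _; set C := w'' *: _.
    set E := w *: ⟦f'', _⟧; set F := w *: ⟦f', _⟧.
    rewrite -!addrA; congr (A + (B + _)).
    by rewrite scalerN (addrCA (- C)) (addrCA (- C)).
  have split4 (V : zmodType) (j p q u j' p' q' u' : V) :
      (j + p + q + u) + (j' + p' + q' + u')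
      = (j + j') + (p + p') + (q + q') + (u + u').
    by rewrite (addrACA (j + p + q)) (addrACA (j + p)) (addrACA j).
  apply: (etrans (congr2 +%R (congr2 +%R (expand f1 f2 f3 w1 w2 w3)
    (expand f2 f3 f1 w2 w3 w1)) (expand f3 f1 f2 w3 w1 w2))).
  rewrite [X in X + _]split4 [LHS]split4 (jacobi f1 f2 f3) add0r.
  rewrite (tele _ (w2 *: b f1 f3) (w3 *: b f2 f1) (w1 *: b f3 f2)) add0r.
  rewrite (mulrC w2 w3) (mulrC w3 w1).
  by apply: (etrans (congr2 +%R (tele _ _ _ _) (tele _ _ _ _))); rewrite addr0.
- have expand (f f' f'' : loop g) (w' w'' : K) :
      cocycle D f (⟦f', f''⟧ + w' *: tdt f'' - w'' *: tdt f')
    = cocycle D f ⟦f', f''⟧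
      + (w' * cocycle D f (tdt f'') - w'' * cocycle D f (tdt f')).
    by rewrite !cocycleDr -scaleNr !cocycleZr mulNr addrA.
  have swap f h : cocycle D f (tdt h) = cocycle D h (tdt f).
    by rewrite cocycleC cocycle_tdt opprK.
  apply: (etrans (congr2 +%R (congr2 +%R (expand f1 f2 f3 w2 w3)
    (expand f2 f3 f1 w3 w1)) (expand f3 f1 f2 w1 w2))).
  rewrite (swap f2 f1) (swap f3 f2) (swap f3 f1).
  rewrite [X in X + _]addrACA [LHS]addrACA cocycle_jacobi add0r.
  by rewrite !subrKA subrr.
Qed.

HB.instance Definition _ := Lmodule_isLie.Build K (affine D)
  affine_bracketPl affine_bracketPr affine_bracketxx affine_jacobi.

End Affine.

Section AffineRoots.
Variables (K : numFieldType) (g : finLieAlgType K) (D : cartanDatum g).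

Definition aff (f : loop g) (z w : K) : affine D := (f, z, w).
Definition loop_part (X : affine D) : loop g := X.1.1.
Definition d_part (X : affine D) : K := X.2.

Lemma affineE X : X = aff (loop_part X) X.1.2 (d_part X).
Proof. by case: X => [[]]. Qed.

Lemma aff_bracketE f z w f' z' w' :
  ⟦aff f z w, aff f' z' w'⟧ =
  aff (⟦f, f'⟧ + w *: tdt f' - w' *: tdt f) (cocycle D f f') 0.
Proof. by []. Qed.

(** Elements of the affine root lattice are row vectors of coordinates in
    [alpha_0, ..., alpha_n]; the index set [I] is ['I_(rank D).+1] and
    [alpha_i], [i != 0], is the simple root of index [unlift ord0 i]. *)
Definition fin_to_aff (c : 'rV[int]_(rank D)) : 'rV[int]_(rank D).+1 :=
  \row_i (if unlift ord0 i is Some j then c 0 j else 0).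

Definition aff_simple (i : 'I_(rank D).+1) : 'rV[int]_(rank D).+1 :=
  delta_mx 0 i.

(** [alpha_0 + theta] *)
Definition imag_root : 'rV[int]_(rank D).+1 :=
  aff_simple ord0 + fin_to_aff (theta D).

Definition aff_cartan (h : subvs_of (csa D)) (z w : K) : affine D :=
  aff (mono 0 (vsval h)) z w.

(** The value of [alpha_i] at [h + z c + w d]; it does not depend on [z], and
    [alpha_0 = delta - theta] where [delta] maps [h + z c + w d] to [w]. *)
Definition aff_simple_eval (i : 'I_(rank D).+1) (h : subvs_of (csa D)) (w : K)
    : K :=
  if unlift ord0 i is Some j then simple_root j h
  else w - root_eval (theta D) h.

Definition aff_eval (a : 'rV[int]_(rank D).+1) (h : subvs_of (csa D)) (w : K)
    : K :=
  \sum_(i < (rank D).+1) aff_simple_eval i h w *~ a 0 i.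

Definition aff_root_space (a : 'rV[int]_(rank D).+1) : set (affine D) :=
  [set X | forall h z w, ⟦aff_cartan h z w, X⟧ = aff_eval a h w *: X].

(** The standard Borel subalgebra
    [g ⊗ t C[t] + fin_borel ⊗ 1 + C c + C d]. *)
Definition borel : set (affine D) :=
  [set X | (forall r : int, r < 0 -> loop_part X r = 0) /\
           loop_part X 0 \in fin_borel D].

Variable J : {set 'I_(rank D).+1}.

Definition parabolic : lieSubalg (affine D) :=
  lie_gen (borel `|` [set X | exists2 j, j \in J &
                              aff_root_space (- aff_simple j) X]).

(** [(p_J ∩ [g, g]) / C c] inside the loop algebra: the image of
    [p_J ∩ [g, g]] under [f + z c |-> f]. *)
Definition ptilde_set : set (loop g) :=
  [set f | exists z : K, parabolic (aff f z 0) /\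
                         derived (affine D) (aff f z 0)].

Lemma is_subalgebra_ptilde : is_subalgebra ptilde_set.
Proof.
have [[p0 pD] pL] := lieSubalgP parabolic.
have [[d0 dD] dL] := lieSubalgP (derived (affine D)).
have affD (a : K) (f h : loop g) (z z' : K) :
    aff (a *: f + h) (a * z + z') 0 = a *: aff f z 0 + aff h z' 0.
  by congr (_, _, _); rewrite /= scaler0 addr0.
split; first split; first by exists 0; split; [exact: p0 | exact: d0].
  move=> a f h [z [pf df]] [z' [ph dh]]; exists (a * z + z').
  by rewrite affD; split; [apply: pD | apply: dD].
move=> f h [z [pf df]] [z' [ph dh]]; exists (cocycle D f h).
have -> : aff ⟦f, h⟧ (cocycle D f h) 0 = ⟦aff f z 0, aff h z' 0⟧.
  by rewrite aff_bracketE !scale0r addr0 subr0.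
by split; [apply: pL | apply: dL].
Qed.

Definition ptilde : lieSubalg (loop g) := LieSubalg is_subalgebra_ptilde.

Definition gr (a : 'rV[int]_(rank D).+1) : int := \sum_(i | i \notin J) a 0 i.

(** The weight space of weight [a] for the adjoint action of the affine Cartan
    subalgebra on the loop algebra, which is [[g, g] / C c]. *)
Definition loop_weight_space (a : 'rV[int]_(rank D).+1) : set (loop g) :=
  [set f | forall h z w,
     loop_part ⟦aff_cartan h z w, aff f 0 0⟧ = aff_eval a h w *: f].

Definition ptilde_degree (k : int) : set (loop g) :=
  lin_span [set f | ptilde f /\
                    exists2 a, gr a = k & loop_weight_space a f].

End AffineRoots.

(** * The fixed-point subalgebra of the current algebra *)

Section Current.
Variables (K : fieldType) (g : lieAlgType K).

Definition current_set : set (loop g) :=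
  [set f | forall r : int, r < 0 -> f r = 0].

Definition t_degree (k : int) : set (loop g) :=
  [set f | forall r : int, r != k -> f r = 0].

Variables (xi : K) (sigma : lieHom g g).

Fact sigma_loop_subproof (f : loop g) :
  (fun r : int => xi ^ (- r) *: sigma (f r)) \in @finsupp_pred K g.
Proof.
apply/asboolP; apply: (sub_finite_set _ (loop_finite f)) => r /=.
by apply: contra_neq => ->; rewrite raddf0 scaler0.
Qed.

(** [x ⊗ t^r |-> xi^(-r) sigma(x) ⊗ t^r] *)
Definition sigma_loop (f : loop g) : loop g := Loop (sigma_loop_subproof f).

Definition current_fixed_set : set (loop g) :=
  [set f | current_set f /\ sigma_loop f = f].

Lemma is_subalgebra_current : is_subalgebra current_set.
Proof.
split=> [|f h f0 h0 n n0]; first split=> // a f h f0 h0 r r0.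
  by rewrite loopDE loopZE f0 // h0 // scaler0 addr0.
apply: fsbig1 => r _ /=; have [r0|r0] := ltP r 0; first by rewrite f0 ?bracket0l.
by rewrite h0 ?bracket0r // subr_lt0 (lt_le_trans n0).
Qed.

Lemma is_subalgebra_current_fixed : is_subalgebra current_fixed_set.
Proof.
have [[c0 cD] cL] := is_subalgebra_current.
have sE f : sigma_loop f = f -> forall r, xi ^ (- r) *: sigma (f r) = f r.
  by move=> sf r; rewrite -[in RHS]sf.
split; first split.
- by split=> //; apply: loopP => r; rewrite /= raddf0 scaler0.
- move=> a f h [fc fs] [hc hs]; split; first exact: cD.
  apply: loopP => r; rewrite /= linearP scalerDr scalerA mulrC -scalerA.
  by rewrite !sE.
move=> f h [fc fs] [hc hs]; split; first exact: cL.
apply: loopP => n; rewrite /= /loop_bracket_fun.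
have f0 i : i \notin fset_set [set r | f r != 0] -> f i = 0.
  rewrite in_fset_set; last exact: loop_finite.
  by rewrite notin_setE /= => /negP/negPn/eqP.
rewrite !(fsbigTE (fset_set [set r | f r != 0])); last first.
  by move=> i /f0->; rewrite bracket0l.
rewrite raddf_sum scaler_sumr; apply: eq_bigr => r _.
transitivity (xi ^ (- n) *: ⟦sigma (f r), sigma (h (n - r))⟧).
  by congr (_ *: _); exact: lie_morph.
have [r0|r0] := ltP r 0; first by rewrite fc // raddf0 !bracket0l scaler0.
have [nr0|nr0] := ltP (n - r) 0.
  by rewrite hc // raddf0 !bracket0r scaler0.
rewrite -[in RHS](sE f) // -[in RHS](sE h) // bracketZl bracketZr scalerA.
congr (_ *: _); rewrite -{1}[n](subrK r) addrC.
case: r r0 {nr0} (n - r) nr0 => [r|//] _ [q|//] _.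
by rewrite -PoszD -!exprnN exprD invfM.
Qed.

(** The Lie algebra [g[t]^sigma]. *)
Definition current_fixed : lieSubalg (loop g) :=
  LieSubalg is_subalgebra_current_fixed.

End Current.

(** * The automorphism [sigma] and the isomorphism *)

Section Main.
Variables (K : numFieldType) (g : finLieAlgType K) (D : cartanDatum g).
Variable J : {set 'I_(rank D).+1}.

Definition s_exp (i : 'I_(rank D).+1) : nat := i \notin J.

Definition is_kac_automorphism (m : nat) (xi : K) (sigma : lieHom g g) : Prop :=
  [/\ bijective sigma,
      forall k : nat, iter k sigma =1 id <-> (m %| k)%N,
      forall i : 'I_(rank D),
        sigma (rvec (simple_coords i)) =
        xi ^+ s_exp (lift ord0 i) *: rvec (simple_coords i) &
      sigma (rvec (- theta D)) = xi ^+ s_exp ord0 *: rvec (- theta D)].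

Variables (xi : K) (sigma : lieHom g g).

Definition regrades
    (phi : subLie (ptilde J) -> subLie (current_fixed xi sigma)) : Prop :=
  [/\ forall (a : 'rV[int]_(rank D)) (r : int) (u : subLie (ptilde J)),
        pos_root a -> subLie_val u = mono r (rvec a) ->
        subLie_val (phi u) =
        mono (gr J (fin_to_aff a + imag_root D *~ r)) (rvec a),
      forall (a : 'rV[int]_(rank D)) (r : int) (u : subLie (ptilde J)),
        pos_root a -> subLie_val u = mono r (rvec (- a)) ->
        subLie_val (phi u) =
        mono (gr J (- fin_to_aff a + imag_root D *~ r)) (rvec (- a)) &
      forall (h : g) (r : int) (u : subLie (ptilde J)),
        h \in csa D -> subLie_val u = mono r h ->
        subLie_val (phi u) = mono (gr J (imag_root D *~ r)) h].

Definition is_graded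
    (phi : subLie (ptilde J) -> subLie (current_fixed xi sigma)) : Prop :=
  forall (k : int) (u : subLie (ptilde J)),
    ptilde_degree J k (subLie_val u) <-> t_degree k (subLie_val (phi u)).

End Main.

(* Main.v *)
(** The degree [gr_J (alpha + r delta)] is additive under the bracket, so
    [x_alpha ⊗ t^r |-> x_alpha ⊗ t^(gr_J (alpha + r delta))] is an injective
    endomorphism of the loop algebra. As [sigma] acts on [x_alpha] by [xi^(gr_J
    alpha)], its image consists of the [sigma]-fixed loops, and it remains to
    see that [ptilde J] is spanned by the weight vectors of nonnegative degree.
    One inclusion holds on generators; for the other, every negative real root
    of degree [0] is reached from some [- alpha_j], [j] in [J], by successively
    subtracting simple roots in [J] through roots: below [- alpha_0 = theta -
    delta] this holds because [theta] is the only root [c] for which no [c +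
    alpha_i] is a root or [0]. The positivity needed for this comes from the
    form [sum_c c(h_a) c(h_b)], computed by telescoping along root strings. *)
From HB Require Import structures.
From mathcomp Require Import all_boot all_order all_algebra.
From mathcomp Require Import finmap all_classical.
From mathcomp Require Import ring.
From mathcomp Require Import reals complex.
Require Import Defs.

Set Implicit Arguments.
Unset Strict Implicit.
Unset Printing Implicit Defensive.

Import Order.TTheory GRing.Theory Num.Theory.

Local Open Scope ring_scope.

(** * Root vectors *)

(** All statements about loops are read off coordinates in the Chevalley basis. The coefficient of a
    basis vector of weight alpha at t^r moves to t^n with n = gr_J(alpha) + r m; then n >= 0 is the
    current condition, n congruent to gr_J(alpha) modulo m is the fixed-point condition, and r is
    recovered from n. What confines the generation argument to few cases is |gr_J(alpha)| <= m, a
    consequence of m = gr_J(alpha_0) + gr_J(theta) with theta highest. A term of nonnegative degree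
    thus has r >= -1, and r = -1 forces gr_J(alpha) = m. The root datum gives no inner product:
    closure under negation, integrality of b(h_a) and the fact that a(h_b) and b(h_a) have the same
    sign are all extracted from the Chevalley relations. Integrality matters for signs too, because
    the ground field is only partially ordered: it makes the numbers compared real and their squares
    nonnegative. The chain from theta serves twice: it also carries the action of [sigma] from
    x_theta^- and the x_i^+ to all root vectors. *)

Lemma inj_nat_escape (T : eqType) (f : nat -> T) (s : seq T) :
  injective f -> exists N : nat, forall q : nat, (N <= q)%N -> f q \notin s.
Proof.
move=> finj; elim: s => [|x s [N Ns]]; first by exists 0%N.
have [[q fq]|/forallNP nf] := pselect (exists q, f q = x).
  exists (maxn N q.+1) => p; rewrite geq_max => /andP[Np qp].
  rewrite inE negb_or Ns // andbT -fq (inj_eq finj).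
  by rewrite eq_sym neq_ltn qp.
exists N => p Np; rewrite inE negb_or Ns // andbT.
by apply/eqP; exact: nf.
Qed.

Lemma mulrn_inj n (a b : 'rV[int]_n) :
  a != 0 -> injective (fun p : nat => b + a *+ p).
Proof.
move=> a0 p q /addrI pq.
have [i ai] : exists i, a 0 i != 0.
  apply/existsP; apply: contraNT a0; rewrite negb_exists => /forallP ai.
  by apply/eqP/rowP=> i; rewrite mxE; apply/eqP; have := ai i; rewrite negbK.
have /eqP : (a *+ p) 0 i = (a *+ q) 0 i by rewrite pq.
rewrite !mulmxnE -[a 0 i *+ p]mulr_natr -[a 0 i *+ q]mulr_natr.
by rewrite (inj_eq (mulfI ai)) eqr_nat => /eqP.
Qed.

Lemma bracketNr (K : fieldType) (L : lieAlgType K) (x y : L) :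
  ⟦x, - y⟧ = - ⟦x, y⟧.
Proof. exact: raddfN. Qed.

Section RootVectors.
Variables (K : numFieldType) (g : finLieAlgType K) (D : cartanDatum g).
Hypothesis D_root : is_root_datum D.
Hypothesis D_chevalley : is_chevalley_basis D.
Implicit Types a b c : 'rV[int]_(rank D).

Local Notation H := (csa D).
Local Notation V := (<<[seq rvec c | c <- roots D]>>%VS : {vspace g}).

Lemma root_eval0 : root_eval (0 : 'rV[int]_(rank D)) = 0 :> dualv H.
Proof. by apply: big1 => i _; rewrite mxE mulr0z. Qed.

Lemma root_evalD a b : root_eval (a + b) = root_eval a + root_eval b.
Proof. by rewrite -big_split; apply: eq_bigr => i _; rewrite mxE mulrzDr. Qed.

Lemma root_evalN a : root_eval (- a) = - root_eval a.
Proof.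
by rewrite /root_eval -sumrN; apply: eq_bigr => i _; rewrite mxE mulrNz.
Qed.

Lemma root_eval_simple i :
  root_eval (simple_coords i) = simple_root i :> dualv H.
Proof.
rewrite /root_eval (bigD1 i) //= big1 => [|j ji]; first
  by rewrite mxE !eqxx addr0.
by rewrite mxE eqxx /= (negPf ji).
Qed.

Lemma rvec_weight c (h : subvs_of H) :
  c \in roots D -> ⟦vsval h, rvec c⟧ = (root_eval c h : K) *: rvec c.
Proof. by case: D_chevalley => /(_ c) + _ _ _ _ rc => /(_ rc)/(_ h). Qed.

Lemma rvec_weightr c x : c \in roots D -> x \in H ->
  ⟦rvec c, x⟧ = - (root_eval c (vsproj H x) : K) *: rvec c.
Proof.
by move=> rc xH; rewrite bracketC -[X in ⟦X, _⟧](vsprojK xH) rvec_weight //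
  scaleNr.
Qed.

Lemma coroot_csa c : c \in roots D -> coroot c \in H.
Proof. by case: D_chevalley => _ /(_ c) + _ _ _ rc => /(_ rc)[]. Qed.

Lemma root_eval_coroot c : c \in roots D ->
  root_eval c (vsproj H (coroot c)) = 2%:R.
Proof. by case: D_chevalley => _ /(_ c) + _ _ _ rc => /(_ rc)[]. Qed.

Lemma roots_neq0 : 0 \notin roots D.
Proof.
case: D_root => _ [_ rootsP] _ _; apply/negP => /rootsP[].
by rewrite root_eval0 eqxx.
Qed.

Lemma rvec_neq0 c : c \in roots D -> rvec c != 0 :> g.
Proof.
move=> rc; apply/eqP => xc0; have := root_eval_coroot rc.
rewrite /coroot xc0 bracket0l !linear0 => /esym/eqP.
by rewrite pnatr_eq0.
Qed.

Lemma chevalley_free :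
  free ([seq coroot (simple_coords i) | i <- enum 'I_(rank D)]
          ++ [seq rvec c | c <- roots D]).
Proof. by case: D_chevalley => _ _ _ _ /basis_free. Qed.

Lemma csa_span :
  H = <<[seq coroot (simple_coords i) | i <- enum 'I_(rank D)]>>%VS.
Proof. by case: D_chevalley => _ _ _ /span_basis ->. Qed.

Lemma csa_capV : (H :&: V = 0)%VS.
Proof. by have := chevalley_free;
  rewrite cat_free csa_span directv_addE => /and3P[_ _ /andP[_ /andP[_ /eqP]]].
  Qed.

Lemma csaDV : (H + V = fullv)%VS.
Proof. by case: D_chevalley => _ _ _ _ /span_basis;
  rewrite span_cat csa_span. Qed.

(** The Chevalley relation gives a bracket only once the last p with b - p a a root is supplied.
    Since a is nonzero, the multiples of a leave the finite list of roots for good, so such a p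
    exists. *)
Lemma root_string_max a b : a != 0 -> b \in roots D ->
  exists2 p : nat, b - a *+ p \in roots D &
    forall q : nat, (p < q)%N -> b - a *+ q \notin roots D.
Proof.
move=> a0 rb; have Na0 : - a != 0 by rewrite oppr_eq0.
have [N NP] := inj_nat_escape (roots D) (mulrn_inj (b := b) Na0).
pose P (p : nat) := b - a *+ p \in roots D.
have P0 : exists p, P p by exists 0%N; rewrite /P mulr0n subr0.
have PN p : P p -> (p <= N)%N.
  move=> Pp; rewrite leqNgt; apply/negP => /ltnW/NP.
  by rewrite mulNrn => /negP.
have [p Pp pmax] := ex_maxnP P0 PN.
by exists p => // q pq; apply: contraTN pq => /pmax; rewrite -leqNgt.
Qed.

Lemma bracket_rvec_root a b : a \in roots D -> b \in roots D ->
  a + b \in roots D ->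
  exists2 n : K, n != 0 & ⟦rvec a, rvec b⟧ = n *: rvec (a + b).
Proof.
move=> ra rb rab.
have a0 : a != 0 by apply: contraTneq ra => ->; exact: roots_neq0.
have [p pP pmax] := root_string_max a0 rb.
have ab0 : a + b != 0 by apply: contraTneq rab => ->; exact: roots_neq0.
case: D_chevalley => _ _ /(_ a b ra rb ab0) + _ _; rewrite rab.
move=> /(_ p pP pmax) [->|->]; [exists p.+1%:R | exists (- p.+1%:R)];
  by rewrite ?oppr_eq0 ?pnatr_eq0 // ?scaleNr scaler_nat.
Qed.

Lemma bracket_rvec0 a b : a \in roots D -> b \in roots D ->
  a + b != 0 -> a + b \notin roots D -> ⟦rvec a, rvec b⟧ = 0 :> g.
Proof.
move=> ra rb ab0 /negPf rab.
by case: D_chevalley => _ _ /(_ a b ra rb ab0) + _ _; rewrite rab.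
Qed.

(** If - c is not a root, [rvec (- c)] is an arbitrary vector of the algebra. Yet x_c brackets the
    Cartan subalgebra into the line of x_c, and each x_b into the line of x_(c+b) or to 0, as b is
    never - c. So h_c lies in the span of the root vectors, which meets the Cartan subalgebra in 0,
    against c(h_c) = 2. *)
Lemma rootsN c : c \in roots D -> - c \in roots D.
Proof.
move=> rc; apply: contraT => rNc; exfalso.
suff : coroot c = 0.
  move=> c0; have := root_eval_coroot rc.
  by rewrite c0 !linear0 => /esym/eqP; rewrite pnatr_eq0.
suff cV : coroot c \in V.
  by apply/eqP; rewrite -memv0 -csa_capV memv_cap coroot_csa.
have : rvec (- c) \in (H + V)%VS by rewrite csaDV memvf.
rewrite /coroot; move: (rvec (- c)) => y /memv_addP[h hH [v vV ->]].
rewrite bracketDr memvD //.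
  by rewrite rvec_weightr // memvZ // memv_span // map_f.
rewrite [v](coord_span (X := in_tuple _) vV) raddf_sum memv_suml // => i _.
rewrite [X in X \in _]bracketZr memvZ //.
have : (in_tuple [seq rvec c | c <- roots D])`_i \in [seq rvec c | c <- roots
  D].
  by rewrite /= mem_nth.
move=> /mapP[b rb ->].
have cb0 : c + b != 0.
  by apply: contraNneq rNc => /eqP; rewrite addr_eq0 => /eqP->; rewrite opprK.
have [rcb|rcb] := boolP (c + b \in roots D).
  have [n _ ->] := bracket_rvec_root rc rb rcb.
  by rewrite memvZ // memv_span // map_f.
by rewrite bracket_rvec0 ?mem0v.
Qed.

Lemma mem_rootsN c : (- c \in roots D) = (c \in roots D).
Proof. by apply/idP/idP => /rootsN //; rewrite opprK. Qed.

Lemma simple_in_roots i : simple_coords i \in roots D.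
Proof.
by case: D_root => _ [_ rootsP] [_ ? _] _; apply/rootsP;
  rewrite root_eval_simple.
Qed.

Lemma corootN c : coroot (- c) = - coroot c :> g.
Proof. by rewrite /coroot opprK bracketC. Qed.

Lemma csa_ind (P : g -> Prop) :
  (forall (k : K) x y, P x -> P y -> P (k *: x + y)) -> P 0 ->
  (forall i : 'I_(rank D), P (coroot (simple_coords i))) ->
    forall h, h \in H -> P h.
Proof.
move=> PD P0 Pc h; rewrite csa_span => hH.
rewrite [h](coord_span (X := in_tuple _) hH).
apply: big_rec => // i x _ Px; apply: PD => //.
have : (in_tuple [seq coroot (simple_coords i) | i <- enum 'I_(rank D)])`_i
  \in [seq coroot (simple_coords i) | i <- enum 'I_(rank D)]
    by rewrite /= mem_nth.
by move=> /mapP[j _ ->].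
Qed.

(** The simple coroots span, and each is a bracket of vectors of opposite weights. By the Jacobi
    identity, bracketing it with h multiplies it by the sum of these weights, which is 0. *)
Lemma csa_abelian h h' : h \in H -> h' \in H -> ⟦h, h'⟧ = 0.
Proof.
move=> hH; elim/csa_ind => [k x y x0 y0||i].
- by rewrite bracketPr x0 y0 scaler0 addr0.
- by rewrite bracket0r.
have ri := simple_in_roots i; have rNi := rootsN ri.
rewrite /coroot; set x := rvec _; set y := rvec _.
have := jacobi h x y; rewrite -{2 3}[h](vsprojK hH).
have -> : ⟦y, vsval (vsproj H h)⟧ =
  (root_eval (simple_coords i) (vsproj H h) : K) *: y.
  by rewrite bracketC rvec_weight // root_evalN opp_lfunE scaleNr opprK.
rewrite rvec_weight // !bracketZr -addrA -scalerDr [⟦y, x⟧]bracketC subrr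
  scaler0.
by rewrite addr0.
Qed.

End RootVectors.

(** * Root strings and Cartan integers *)

Section RootStrings.
Variables (K : numFieldType) (g : finLieAlgType K) (D : cartanDatum g).
Hypothesis D_root : is_root_datum D.
Hypothesis D_chevalley : is_chevalley_basis D.
Implicit Types a b c : 'rV[int]_(rank D).

Local Notation H := (csa D).

(** The Cartan integer b(h_a). It is additive in [b] only; signs are transferred to the other
    argument through [root_norm_pairing]. *)
Definition pairing b a : K := root_eval b (vsproj H (coroot a)).

Lemma pairing0l a : pairing 0 a = 0.
Proof. by rewrite /pairing root_eval0 lfunE. Qed.

Lemma pairingDl a b c : pairing (a + b) c = pairing a c + pairing b c.
Proof. by rewrite /pairing root_evalD add_lfunE. Qed.

Lemma pairingNl a b : pairing (- a) b = - pairing a b.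
Proof. by rewrite /pairing root_evalN opp_lfunE. Qed.

Lemma pairingMnl a b n : pairing (a *+ n) b = pairing a b *+ n.
Proof. by elim: n => [|n IH]; rewrite ?pairing0l // !mulrS pairingDl IH. Qed.

Lemma pairingNr a b : pairing a (- b) = - pairing a b.
Proof. by rewrite /pairing corootN !linearN. Qed.

Lemma pairing_coroot a : a \in roots D -> pairing a a = 2%:R.
Proof. exact: root_eval_coroot. Qed.

Lemma pairing_sum a b :
  pairing a b = \sum_i (a 0 i)%:~R * pairing (simple_coords i) b.
Proof.
rewrite /pairing {1}/root_eval sum_lfunE; apply: eq_bigr => i _.
by rewrite -scaler_int scale_lfunE root_eval_simple.
Qed.

Lemma root_vec_inj a (k l : K) : a \in roots D ->
  k *: rvec a = l *: rvec a :> g -> k = l.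
Proof.
move=> ra /eqP; rewrite -subr_eq0 -scalerBl scaler_eq0 (negPf (rvec_neq0
  D_chevalley ra)).
by rewrite orbF subr_eq0 => /eqP.
Qed.

Definition struct_const a b : K :=
  if pselect (a + b \in roots D /\
              exists k : K, ⟦rvec a, rvec b⟧ = k *: rvec (a + b)) is left p
  then sval (cid (proj2 p)) else 0.

Lemma struct_const0 a b : a + b \notin roots D -> struct_const a b = 0.
Proof. by move=> /negP rab; rewrite /struct_const; case: pselect => // -[]. Qed.

Lemma struct_constP a b : a \in roots D -> b \in roots D -> a + b != 0 ->
  ⟦rvec a, rvec b⟧ = struct_const a b *: rvec (a + b).
Proof.
move=> ra rb ab0; rewrite /struct_const; case: pselect => [p|np].
  exact: (svalP (cid (proj2 p))).
rewrite scale0r; apply: bracket_rvec0 => //; apply/negP => rab.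
by case: np; split=> //; have [n _ nE] :=
  bracket_rvec_root D_root D_chevalley ra rb rab; exists n.
Qed.

Lemma struct_constxx a : a \in roots D -> struct_const a a = 0.
Proof.
move=> ra; have [raa|/struct_const0//] := boolP (a + a \in roots D).
have aa0 : a + a != 0 by apply: contraTneq raa => ->; exact: roots_neq0.
apply: (@root_vec_inj (a + a)) => //.
by rewrite -struct_constP // bracketxx scale0r.
Qed.

Local Notation Phi0 := (0 :: roots D).

(** [u c] is the eigenvalue of [ad x_a \o ad x_(-a)] on the line of weight [c]
    (for [c = 0], on [h_a]), and [h_a = ⟦x_a, x_(-a)⟧]. *)
Lemma root_string_telescope a : a \in roots D ->
  exists2 u : 'rV[int]_(rank D) -> K,
    forall c, c \in Phi0 -> pairing c a = u c - u (c + a) &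
    forall c, ~~ ((c \in Phi0) && (c - a \in Phi0)) -> u c = 0.
Proof.
move=> ra; have rNa := rootsN D_root D_chevalley ra.
have a0 : a != 0 by apply: contraTneq ra => ->; exact: roots_neq0.
have Na0 : - a != 0 by rewrite oppr_eq0.
have NaNa : (- a == a) = false.
  apply/negP => /eqP Naa; have := pairingNr a a; rewrite Naa => /eqP.
  by rewrite -subr_eq0 opprK -mulr2n mulrn_eq0 /= pairing_coroot // pnatr_eq0.
(* Both exceptional values are 2: x_(-a) sends h_a to 2 x_(-a), which x_a sends to 2 h_a; and x_(-a)
   sends x_a to - h_a, which x_a sends to 2 x_a. *)
exists (fun c => if (c == 0) || (c == a) then 2%:R else
   if (c \in roots D) && (c - a \in roots D)
   then struct_const (- a) c * struct_const a (c - a) else 0); last first.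
  move=> c; case: eqP => [->|/eqP c0] /=.
    by rewrite sub0r !inE eqxx rNa (negPf Na0).
  case: eqP => [->|/eqP ca] /=; first by rewrite subrr !inE ra eqxx (negPf a0).
  by rewrite !inE subr_eq0 (negPf c0) (negPf ca) /= => /negPf->.
move=> c; rewrite inE => /orP[/eqP->|rc].
  by rewrite pairing0l !add0r !eqxx (negPf a0) /= subrr.
have c0 : c != 0 by apply: contraTneq rc => ->; exact: roots_neq0.
(* For c = - a and c = a one of the two terms is an exceptional value 2; the other contains a
   structure constant of a root vector with itself and vanishes. *)
have [cNa|cNa] := eqVneq c (- a).
  rewrite {}cNa addNr eqxx /= (negPf Na0) NaNa /= pairingNl pairing_coroot //.
  by rewrite struct_constxx // mul0r; case: ifP; rewrite sub0r.
have ca0 : c + a != 0 by rewrite addr_eq0.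
have [ca|ca] := eqVneq c a.
  rewrite {}ca -[a + a == a]subr_eq0 addrK orbT.
  rewrite (negPf a0) orbF addr_eq0 eq_sym NaNa ?addrK.
  by rewrite struct_constxx // mulr0; case: ifP; rewrite subr0 pairing_coroot.
rewrite (negPf c0) (negPf ca0) -[c + a == a]subr_eq0 addrK (negPf c0) /= rc
  andbT.
apply: (root_vec_inj rc).
have hE : ⟦coroot a, rvec c⟧ = pairing c a *: rvec c.
  by rewrite -[X in ⟦X, _⟧](vsprojK (coroot_csa D_chevalley ra)) rvec_weight.
have jac : ⟦coroot a, rvec c⟧ =
    ⟦rvec a, ⟦rvec (- a), rvec c⟧⟧ - ⟦rvec (- a), ⟦rvec a, rvec c⟧⟧.
  have := jacobi (rvec c) (rvec a) (rvec (- a)); rewrite -/(coroot a).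
  rewrite [⟦rvec c, coroot a⟧]bracketC [⟦rvec c, rvec a⟧]bracketC bracketNr.
  by move=> /eqP; rewrite -addrA addrC subr_eq0 => /eqP<-.
have sE x : x \in roots D -> x != - a -> x != a -> x != 0 ->
    ⟦rvec a, ⟦rvec (- a), rvec x⟧⟧ =
    (if x - a \in roots D then struct_const (- a) x * struct_const a (x - a)
      else 0) *: rvec x.
  move=> rx xNa xa x0; rewrite struct_constP // 1?addrC ?subr_eq0 //.
  case: ifP => [rxa|/negbT rxa]; last first.
    by rewrite struct_const0 1?addrC // bracketZr !scale0r.
  by rewrite bracketZr struct_constP // addrCA subrr addr0 // scalerA.
(* In the opposite order the eigenvalue on x_c is the same product of structure constants taken at c
   + a, that is u (c + a). *)
have sE' x : x \in roots D -> x != - a -> x != a -> x != 0 ->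
    ⟦rvec (- a), ⟦rvec a, rvec x⟧⟧ =
    (if x + a \in roots D then struct_const (- a) (x + a) * struct_const a x
      else 0) *: rvec x.
  move=> rx xNa xa x0; rewrite struct_constP // 1?addrC ?addr_eq0 //.
  case: ifP => [rxa|/negbT rxa]; last first.
    by rewrite struct_const0 1?addrC // bracketZr !scale0r.
  by rewrite bracketZr struct_constP // addrCA addNr addr0 // scalerA mulrC.
by rewrite -hE jac sE // sE' // -scalerBl.
Qed.

(** Here b is the bottom of its a-string and N the number of steps to the top. The telescoping
    function vanishes at the bottom and one step past the top, which determines b(h_a). Counting 0
    as a member keeps strings through 0 unbroken. *)
Lemma pairing_end a b : a \in roots D -> b \in Phi0 -> b - a \notin Phi0 ->
  exists N : nat, pairing b a = - N%:R.
Proof.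
move=> ra bP baP; have [u uE u0] := root_string_telescope ra.
have a0 : a != 0 by apply: contraTneq ra => ->; exact: roots_neq0.
have [N [NP bndP]] : exists N : nat, b + a *+ N.+1 \notin Phi0 /\
    forall q : nat, (q <= N)%N -> b + a *+ q \in Phi0.
  have [M MP] := inj_nat_escape Phi0 (mulrn_inj (b := b) a0).
  have exP : exists n : nat, b + a *+ n \notin Phi0 by exists M; exact: MP.
  have [n nP nmin] := ex_minnP exP.
  case: n => [|n] in nP nmin *; first by rewrite mulr0n addr0 bP in nP.
  exists n; split=> // q qn; apply: contraLR qn => /nmin.
  by rewrite -ltnNge.
exists N.
(* Each step j subtracts (b + j a)(h_a) = b(h_a) + 2 j; the sum over j < q is q (b(h_a) + q - 1). At
   q = N + 1 the left side is 0 and the factor N + 1 cancels. *)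
have uq (q : nat) : (q <= N.+1)%N ->
    u (b + a *+ q) = - (q%:R * (pairing b a + (q%:R - 1))).
  elim: q => [_|q IH qN].
    by rewrite mul0r oppr0 mulr0n addr0; apply: u0; rewrite negb_and baP orbT.
  have := uE _ (bndP q qN); rewrite -addrA -mulrSr IH ?(ltnW qN) //.
  rewrite pairingDl pairingMnl pairing_coroot // -[2%:R *+ q]mulr_natr
    -[q.+1%:R]natr1.
  move: (u _) (pairing b a) (q%:R : K) => v p Q uS.
  by rewrite -[LHS](subKr (- (Q * (p + (Q - 1))))) -uS; ring.
have := uq N.+1 (leqnn _); rewrite u0; last by rewrite negb_and NP.
move/eqP; rewrite eq_sym oppr_eq0 mulf_eq0 pnatr_eq0 /= -natr1 addrK.
by rewrite addr_eq0 => /eqP.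
Qed.

Lemma pairing_le0 a b : a \in roots D -> b \in Phi0 -> b - a \notin Phi0 ->
  pairing b a <= 0.
Proof. by move=> ra rb /(pairing_end ra rb)[N ->]; rewrite oppr_le0 ler0n. Qed.

Lemma pairing_ge0 a b : a \in roots D -> b \in Phi0 -> b + a \notin Phi0 ->
  0 <= pairing b a.
Proof.
move=> ra rb ba; rewrite -oppr_le0 -pairingNr pairing_le0 ?opprK //.
exact: rootsN.
Qed.

(** Going down n steps to the bottom of the string changes the value by - 2 n, and at the bottom it
    is - N; hence the value 2 n - N. *)
Lemma pairing_int a b : a \in roots D -> b \in Phi0 ->
  exists z : int, pairing b a = z%:~R.
Proof.
move=> ra rb.
have a0 : a != 0 by apply: contraTneq ra => ->; exact: roots_neq0.
have Na0 : - a != 0 by rewrite oppr_eq0.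
have [M MP] := inj_nat_escape Phi0 (mulrn_inj (b := b) Na0).
have exP : exists n : nat, b + (- a) *+ n \notin Phi0 by exists M; exact: MP.
have [n nP nmin] := ex_minnP exP.
case: n => [|n] in nP nmin *; first by rewrite mulr0n addr0 rb in nP.
have bn : b + - a *+ n \in Phi0.
  by apply: contraT => /nmin; rewrite ltnn.
have [|N] := pairing_end ra bn; first by rewrite -addrA -mulrSr.
rewrite pairingDl pairingMnl pairingNl pairing_coroot // => bE.
exists ((2 * n)%:Z - N%:Z); rewrite rmorphB /= -!pmulrn natrM -bE.
by rewrite -mulr_natr; ring.
Qed.

(** Half the value at (h_a, h_a) of the trace form sum_c c(h) c(h'). The factor 1/2 comes from
    a(h_a) = 2: it makes this the ratio of the form at (h_a, h_b) to a(h_b). *)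
Definition root_norm a : K :=
  2^-1 * \sum_(c <- roots D) pairing c a ^+ 2.

Lemma root_norm_gt0 a : a \in roots D -> 0 < root_norm a.
Proof.
move=> ra; rewrite mulr_gt0 ?invr_gt0 ?ltr0n // (big_rem a) //=.
rewrite ltr_wpDr ?pairing_coroot ?exprn_gt0 ?ltr0n // big_seq sumr_ge0 // => c.
move=> /mem_rem rc; have [|z ->] := @pairing_int a c ra; first
  by rewrite inE rc orbT.
by rewrite -rmorphXn ler0z sqr_ge0.
Qed.

(** Summation by parts: replacing c(h_a) by u c - u (c + a) and shifting the second sum leaves u c
    times (c - (c - a))(h_b) = a(h_b), so t is the sum of the u c. *)
Lemma pairing_sumM a : a \in roots D ->
  exists t : K, forall b, b \in roots D ->
  \sum_(c <- roots D) pairing c a * pairing c b = t * pairing a b.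
Proof.
move=> ra; have [u uE u0] := root_string_telescope ra.
have uPhi : uniq Phi0 by rewrite /= roots_neq0 //; case: D_root => _ [].
exists (\sum_(c <- Phi0) u c) => b rb.
have -> : \sum_(c <- roots D) pairing c a * pairing c b =
          \sum_(c <- Phi0) (u c - u (c + a)) * pairing c b.
  rewrite big_cons pairing0l mulr0 add0r [LHS]big_seq [RHS]big_seq.
  by apply: eq_bigr => c rc; rewrite uE // inE rc orbT.
(* The shift by a does not preserve the index set, but u vanishes at c unless both c and c - a
   belong to it, so the boundary terms on both sides are 0. *)
have shift : \sum_(c <- Phi0) u (c + a) * pairing c b =
             \sum_(c <- Phi0) u c * pairing (c - a) b.
  rewrite (bigID (fun c => c + a \in Phi0)) /= [X in _ + X]big1 ?addr0;
    last first.
    by move=> c ca; rewrite u0 ?mul0r // negb_and ca.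
  rewrite [RHS](bigID (fun c => c - a \in Phi0)) /= [X in _ + X]big1 ?addr0;
    last first.
    by move=> c ca; rewrite u0 ?mul0r // negb_and ca orbT.
  rewrite -[LHS]big_filter -[RHS]big_filter.
  transitivity (\sum_(c <- [seq c + a | c <- [seq c <- Phi0 | c + a \in Phi0]])
                 u c * pairing (c - a) b).
    by rewrite big_map; apply: eq_bigr => c _; rewrite addrK.
  apply: perm_big; apply: uniq_perm.
  - by rewrite map_inj_uniq ?filter_uniq //; apply: addIr.
  - exact: filter_uniq.
  move=> c; apply/mapP/idP => [[d]|].
    by rewrite mem_filter => /andP[da d0] ->; rewrite mem_filter addrK d0 da.
  rewrite mem_filter => /andP[ca c0]; exists (c - a); last by rewrite subrK.
  by rewrite mem_filter subrK c0 ca.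
rewrite (eq_bigr (fun c => u c * pairing c b - u (c + a) * pairing c b));
  last first.
  by move=> c _; rewrite mulrBl.
rewrite sumrB shift -sumrB mulr_suml; apply: eq_bigr => c _.
by rewrite pairingDl pairingNl mulrDr mulrN opprD addrA subrr add0r opprK.
Qed.

(** Both sides are the value of the symmetric trace form at (h_a, h_b). With positive norms, this
    gives a(h_b) and b(h_a) the same sign. *)
Lemma root_norm_pairing a b : a \in roots D -> b \in roots D ->
  root_norm a * pairing a b = root_norm b * pairing b a.
Proof.
have sumE x y : x \in roots D -> y \in roots D ->
    \sum_(c <- roots D) pairing c x * pairing c y = root_norm x * pairing x y.
  move=> rx ry; have [t tE] := pairing_sumM rx.
  rewrite tE //; congr (_ * _); have := tE x rx;
    rewrite pairing_coroot // /root_norm.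
  under eq_bigr do rewrite -expr2.
  by move=> ->; rewrite mulrC mulfK // pnatr_eq0.
move=> ra rb; rewrite -!sumE //; apply: eq_bigr => c _; exact: mulrC.
Qed.

End RootStrings.

(** * Chains of roots *)

Lemma absz_pred_lt (x : int) : 0 <= x - 1 -> (`|(x - 1)%R| < `|x|)%N.
Proof.
move=> x1; rewrite -ltz_nat !gez0_abs ?ltrBlDr ?ltrDl //.
by apply: le_trans x1 _; rewrite lerBlDr lerDl.
Qed.

Section RootOrder.
Variables (K : numFieldType) (g : finLieAlgType K) (D : cartanDatum g).
Hypothesis D_root : is_root_datum D.
Hypothesis D_chevalley : is_chevalley_basis D.
Implicit Types a b c : 'rV[int]_(rank D).

Local Notation H := (csa D).
Local Notation Phi0 := (0 :: roots D).

Lemma root_eval_inj : injective (@root_eval K g D).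
Proof.
move=> a b ab; apply/rowP=> i.
have fr : free [tuple of map (@simple_root K g D) (ord_tuple (rank D))].
  by case: D_root => _ _ [+ _ _] _; rewrite -[enum _]val_ord_tuple.
have /(_ _ i)/wrap[] := elimT freeP fr (fun j => (a 0 j - b 0 j)%:~R).
  rewrite (eq_bigr (fun j => simple_root j *~ a 0 j - simple_root j *~ b 0 j))
    => [|j _].
    by rewrite sumrB -/(root_eval a) -/(root_eval b) ab subrr.
  by rewrite -tnth_nth tnth_map tnth_ord_tuple scaler_int mulrzBr.
by move/eqP; rewrite intr_eq0 subr_eq0 => /eqP.
Qed.

Lemma root_pos_or_neg c : c \in roots D ->
  nonneg_coords c || nonneg_coords (- c).
Proof.
case: D_root => _ [_ rP] [_ _ signP] _ /rP/signP[d /root_eval_inj <-].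
by [].
Qed.

Lemma nonneg_coordsP n (c : 'rV[int]_n) :
  reflect (forall i, 0 <= c 0 i) (nonneg_coords c).
Proof. exact: forallP. Qed.

Lemma root_neq0 c : c \in roots D -> c != 0.
Proof. by move=> rc; apply: contraTneq rc => ->; exact: roots_neq0. Qed.

Lemma nonneg_simple_sub c i : nonneg_coords c -> c != 0 ->
  nonneg_coords (simple_coords i - c) -> c = simple_coords i.
Proof.
move=> /nonneg_coordsP cP c0 /nonneg_coordsP icP.
have ci j : j != i -> c 0 j = 0.
  move=> ji; apply/eqP; rewrite eq_le cP andbT.
  by have := icP j; rewrite !mxE eqxx (negPf ji) /= sub0r oppr_ge0.
have ci1 : c 0 i = 1.
  apply/eqP; rewrite eq_le; have := icP i;
    rewrite !mxE !eqxx /= subr_ge0 => -> /=.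
  rewrite -gtz0_ge1 lt_neqAle cP andbT eq_sym; apply: contra c0 => /eqP ci0.
  by apply/eqP/rowP=> j; rewrite mxE; have [->|/ci] := eqVneq j i.
by apply/rowP=> j; rewrite mxE eqxx /=; have [->|/ci->] := eqVneq j i.
Qed.

Lemma pairing_le0C a b : a \in roots D -> b \in roots D ->
  (pairing a b <= 0) = (pairing b a <= 0).
Proof.
move=> ra rb; rewrite -(pmulr_rle0 _ (root_norm_gt0 D_root D_chevalley ra)).
by rewrite root_norm_pairing // pmulr_rle0 // root_norm_gt0.
Qed.

Lemma pairing_ge0C a b : a \in roots D -> b \in roots D ->
  (0 <= pairing a b) = (0 <= pairing b a).
Proof.
move=> ra rb; rewrite -(pmulr_rge0 _ (root_norm_gt0 D_root D_chevalley ra)).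
by rewrite root_norm_pairing // pmulr_rge0 // root_norm_gt0.
Qed.

(** Otherwise c is the bottom of each of its simple strings, so c(h_i) <= 0, hence alpha_i(h_c) <= 0
    for all i. With nonnegative coordinates this yields c(h_c) <= 0 instead of 2. *)
Lemma simple_descent c : c \in roots D -> nonneg_coords c ->
  exists i, c - simple_coords i \in Phi0.
Proof.
move=> rc /nonneg_coordsP cP; apply: contrapT => /forallNP nP.
suff : pairing c c <= 0 by rewrite pairing_coroot // lern0.
rewrite pairing_sum sumr_le0 // => i _; rewrite mulr_ge0_le0 ?ler0z //.
have ri := simple_in_roots D_root i.
rewrite pairing_le0C // pairing_le0 //; first by rewrite inE rc orbT.
exact/negP/nP.
Qed.

Definition height c : int := \sum_i c 0 i.

Lemma heightD a b : height (a + b) = height a + height b.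
Proof. by rewrite -big_split; apply: eq_bigr => i _; rewrite mxE. Qed.

Lemma heightN a : height (- a) = - height a.
Proof. by rewrite -sumrN; apply: eq_bigr => i _; rewrite mxE. Qed.

Lemma height_simple i : height (simple_coords i) = 1.
Proof.
rewrite /height (bigD1 i) //= big1 => [|j ji]; first by rewrite mxE !eqxx addr0.
by rewrite mxE eqxx /= (negPf ji).
Qed.

Lemma height_ge0 c : nonneg_coords c -> 0 <= height c.
Proof. by move=> /nonneg_coordsP cP; apply: sumr_ge0. Qed.

Lemma pos_root_ind (P : 'rV[int]_(rank D) -> Prop) :
  (forall i, P (simple_coords i)) ->
  (forall c i, c \in roots D -> nonneg_coords c ->
    c + simple_coords i \in roots D -> P c -> P (c + simple_coords i)) ->
  forall c, c \in roots D -> nonneg_coords c -> P c.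
Proof.
move=> P1 PS c; have [n] := ubnP `|height c|%N.
elim: n c => // n IH c cn rc cP.
have [i ci] := simple_descent rc cP.
have [c0|c0] := eqVneq (c - simple_coords i) 0.
  by move/eqP: c0; rewrite subr_eq0 => /eqP->.
have {}ci : c - simple_coords i \in roots D by move: ci; rewrite inE (negPf c0).
have ciP : nonneg_coords (c - simple_coords i).
  (* A root below a simple root with nonnegative coordinates is that simple root, so c - alpha_i
     cannot be negative. *)
  have /orP[//|] := root_pos_or_neg ci; rewrite opprB => icP.
  by move: c0; rewrite (nonneg_simple_sub cP (root_neq0 rc) icP) subrr eqxx.
rewrite -[c](subrK (simple_coords i)); apply: PS; rewrite ?subrK //.
rewrite ltnS in cn; apply: IH => //; apply: leq_trans cn.
rewrite heightD heightN height_simple absz_pred_lt //.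
by have := height_ge0 ciP; rewrite heightD heightN height_simple.
Qed.

Lemma bracket_killed (x y z : g) : ⟦x, z⟧ = 0 -> ⟦y, z⟧ = 0 -> ⟦⟦x, y⟧, z⟧ = 0.
Proof.
move=> xz yz; have := jacobi x y z.
by rewrite yz [⟦z, x⟧]bracketC xz oppr0 !bracket0r !add0r bracketC => /eqP;
  rewrite oppr_eq0 => /eqP.
Qed.

Lemma theta_root : theta D \in roots D.
Proof. by case: D_root => _ _ _ []. Qed.

Lemma theta_max c : c \in roots D -> nonneg_coords (theta D - c).
Proof. by case: D_root => _ _ _ [] _; exact. Qed.

(** Otherwise [c(h_theta) > 0], so [theta - c] is a positive root [b]; but
    [⟦x_b, x_c⟧] is a nonzero multiple of [x_theta] although [x_b] is generated
    by the [x_(alpha_i)], which kill [x_c]. *)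
Lemma simple_ascent c : c \in roots D -> c != theta D ->
  exists i, c + simple_coords i \in Phi0.
Proof.
move=> rc ct; apply: contrapT => /forallNP nP.
have cPhi : c \in Phi0 by rewrite inE rc orbT.
have tPhi : theta D \in Phi0 by rewrite inE theta_root orbT.
(* As c is the top of its simple strings, c(h_i) >= 0, hence alpha_i(h_c) >= 0. Writing theta as
   (theta - c) + c gives theta(h_c) >= 2, whereas theta - c outside the roots and 0 would give
   theta(h_c) <= 0. *)
have gP : theta D - c \in Phi0.
  apply: contraT => tc; exfalso.
  have := pairing_le0 D_root D_chevalley rc tPhi tc; apply/negP;
    rewrite -real_ltNge.
  - rewrite -[theta D](subrK c) pairingDl pairing_coroot // ltr_wpDl ?ltr0n //.
    rewrite pairing_sum sumr_ge0 // => i _; rewrite mulr_ge0 ?ler0z //.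
      by have /nonneg_coordsP := theta_max rc.
    have ri := simple_in_roots D_root i.
    rewrite pairing_ge0C // pairing_ge0 //; exact/negP/nP.
  - exact: real0.
  - by have [z ->] := pairing_int D_root D_chevalley rc tPhi; exact: realz.
have tc0 : theta D - c != 0 by rewrite subr_eq0 eq_sym.
have {}gP : theta D - c \in roots D by move: gP; rewrite inE (negPf tc0).
have rtc : theta D - c + c \in roots D by rewrite subrK theta_root.
have [n n0] := bracket_rvec_root D_root D_chevalley gP rc rtc.
rewrite subrK => tE; suff : ⟦rvec (theta D - c), rvec c⟧ = 0 :> g.
  rewrite tE => /eqP; rewrite scaler_eq0 (negPf n0).
  by rewrite (negPf (rvec_neq0 D_chevalley theta_root)).
have simple0 (i : 'I_(rank D)) : ⟦rvec (simple_coords i), rvec c⟧ = 0 :> g.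
  have ci := nP i; rewrite addrC in ci.
  apply: bracket_rvec0 => //; first exact: simple_in_roots.
    by apply: contra_notN ci => /eqP->; rewrite inE eqxx.
  by apply/negP => ric; apply: ci; rewrite inE ric orbT.
move: (theta D - c) gP (theta_max rc) {rtc tc0 tE};
  apply: pos_root_ind => [//|b i rb bP rbi IH].
have ri := simple_in_roots D_root i.
have [k k0 kE] := bracket_rvec_root D_root D_chevalley rb ri rbi.
have := bracket_killed IH (simple0 i); rewrite kE bracketZl => /eqP.
by rewrite scaler_eq0 (negPf k0) => /eqP.
Qed.

(** Induction on the height of theta - c. The negative simple roots are separate base cases, since
    adding alpha_i to them gives 0 instead of a root. *)
Lemma root_descent_ind (P : 'rV[int]_(rank D) -> Prop) :
  P (theta D) -> (forall i, P (- simple_coords i)) ->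
  (forall c i, c \in roots D -> c + simple_coords i \in roots D ->
    P (c + simple_coords i) -> P c) ->
  forall c, c \in roots D -> P c.
Proof.
move=> Pt P1 PS c; have [n] := ubnP `|height (theta D - c)|%N.
elim: n c => // n IH c cn rc.
have [->//|ct] := eqVneq c (theta D).
have [i ci] := simple_ascent rc ct.
have [c0|c0] := eqVneq (c + simple_coords i) 0.
  by move/eqP: c0; rewrite addr_eq0 => /eqP->.
have {}ci : c + simple_coords i \in roots D by move: ci; rewrite inE (negPf c0).
apply: (PS _ i) => //; apply: IH => //.
have hE : height (theta D - (c + simple_coords i)) = height (theta D - c) - 1.
  by rewrite opprD addrA [LHS]heightD [height (- simple_coords i)]heightN
    height_simple.
have := height_ge0 (theta_max ci); rewrite hE => /absz_pred_lt h1.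
exact: leq_trans h1 cn.
Qed.
End RootOrder.

(** * Regrading a loop algebra *)

Section LoopSpan.
Variables (K : fieldType) (V : lmodType K).

Lemma is_subspace_sum (S : set V) (I : Type) (s : seq I) (P : pred I)
    (F : I -> V) :
  is_subspace S -> (forall i, P i -> S (F i)) -> S (\sum_(i <- s | P i) F i).
Proof.
move=> [S0 SD] SF; apply: big_ind => // x y Sx Sy.
by rewrite -[x]scale1r; apply: SD.
Qed.

Lemma is_subspaceZ (S : set V) (a : K) (x : V) : is_subspace S -> S x ->
  S (a *: x).
Proof. by move=> [S0 SD] Sx; rewrite -[_ *: _]addr0; apply: SD. Qed.

Lemma is_subspaceD (S : set V) (x y : V) : is_subspace S -> S x -> S y ->
  S (x + y).
Proof. by move=> [S0 SD] Sx Sy; rewrite -[x]scale1r; apply: SD. Qed.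

Lemma loop_sumE (I : Type) (s : seq I) (P : pred I) (F : I -> loop V) n :
  (\sum_(i <- s | P i) F i) n = \sum_(i <- s | P i) F i n.
Proof. by elim/big_rec2: _ => // i y1 y2 _ <-; rewrite loopDE. Qed.

Lemma loop_sum_mono (f : loop V) :
  f = \sum_(r <- fset_set [set r | f r != 0]) mono r (f r).
Proof.
apply: loopP => n; rewrite loop_sumE.
have [fn|fn] := eqVneq (f n) 0.
  rewrite fn big1_seq // => r _; rewrite monoE.
  by case: eqP => // <-.
have nf : n \in fset_set [set r | f r != 0].
  by rewrite in_fset_set ?inE //; exact: loop_finite.
rewrite (bigD1_seq n) ?fset_uniq // monoE eqxx big1 => [|r rn]; first
  by rewrite [RHS]addr0.
by rewrite monoE eq_sym (negPf rn).
Qed.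

End LoopSpan.

Section Regrade.
Variables (K : fieldType) (g : finLieAlgType K) (N : nat) (X : N.-tuple g).
Hypothesis X_basis : basis_of fullv X.
Implicit Types (f h : loop g) (x y : g) (i j : 'I_N).

Lemma coord_full x : x = \sum_i coord X i x *: X`_i.
Proof. exact: (coord_basis X_basis (memvf x)). Qed.

Lemma coord_inj x y : (forall i, coord X i x = coord X i y) -> x = y.
Proof.
by move=> xy; rewrite [x]coord_full [y]coord_full; apply: eq_bigr => i _;
  rewrite xy.
Qed.

Lemma coordP i (a : K) x y :
  coord X i (a *: x + y) = a * coord X i x + coord X i y.
Proof. exact: linearP. Qed.

Lemma coord_sum (k : 'I_N -> K) j : coord X j (\sum_i k i *: X`_i) = k j.
Proof. by rewrite coord_sum_free // (basis_free X_basis). Qed.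

Lemma coord_elem i j : coord X j X`_i = (i == j)%:R.
Proof. by rewrite coord_free // (basis_free X_basis). Qed.

Lemma loop_span (S : set (loop g)) f : is_subspace S ->
  (forall i r, coord X i (f r) != 0 -> S (mono r X`_i)) -> S f.
Proof.
move=> Ssub Sf; rewrite [f]loop_sum_mono; apply: is_subspace_sum => // r _.
rewrite [f r]coord_full raddf_sum; apply: is_subspace_sum => // i _ /=.
have [->|fri] := eqVneq (coord X i (f r)) 0.
  by rewrite scale0r raddf0; case: Ssub.
by rewrite linearZ /=; apply: is_subspaceZ => //; apply: Sf.
Qed.

Section Homogeneous.
Variables (T : Type) (deg : 'I_N -> T).

(** The type of degrees is left open because both weights in the root lattice and integer degrees
    are used. *)
Definition homogeneous (k : T) x := forall i, coord X i x != 0 -> deg i = k.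

Lemma homogeneous_elem i : homogeneous (deg i) X`_i.
Proof.
by move=> j; rewrite coord_elem; case: (i =P j) => [->|_] //; rewrite eqxx.
Qed.

Lemma homogeneous0 k : homogeneous k 0.
Proof. by move=> i; rewrite linear0 eqxx. Qed.

Lemma homogeneousP k (a : K) x y :
  homogeneous k x -> homogeneous k y -> homogeneous k (a *: x + y).
Proof.
move=> xk yk i; rewrite coordP; have [xi0|/xk//] := eqVneq (coord X i x) 0.
by rewrite xi0 mulr0 add0r => /yk.
Qed.

Lemma homogeneousZ k (a : K) x : homogeneous k x -> homogeneous k (a *: x).
Proof.
by move=> xk; rewrite -[_ *: _]addr0; apply: homogeneousP => //;
  exact: homogeneous0.
Qed.

End Homogeneous.

Variables (deg : 'I_N -> int) (m : nat).
Hypothesis m_gt0 : (0 < m)%N.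

(** The map is given by the coefficients of its image: t^n receives X_i from the only r with deg i +
    r m = n, and nothing if n - deg i is not divisible by m. *)
Fact regrade_subproof f :
  (fun n : int => \sum_i
    (if (m %| n - deg i)%Z then coord X i (f ((n - deg i) %/ m)%Z) else 0) *:
      X`_i)
    \in @finsupp_pred K g.
Proof.
apply/asboolP; apply: (@sub_finite_set _ _
  [set deg i + r * m%:Z | i in [set: 'I_N] & r in [set r | f r != 0]]%classic).
  move=> n /= n0; apply: contrapT => nP; move/eqP: n0; apply.
  apply: big1 => i _; case: ifP => [mn|_]; last by rewrite scale0r.
  have [->|fn] := eqVneq (f ((n - deg i) %/ m)%Z) 0; first
    by rewrite linear0 scale0r.
  case: nP; exists i => //; exists ((n - deg i) %/ m)%Z => //.
  by rewrite divzK // addrC subrK.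
by apply: finite_image2; [exact: finite_finset | exact: loop_finite].
Qed.

(** [X_i ⊗ t^r |-> X_i ⊗ t^(deg i + r m)] *)
Definition regrade f : loop g := Loop (regrade_subproof f).

Lemma coord_regrade f n j : coord X j (regrade f n) =
  if (m %| n - deg j)%Z then coord X j (f ((n - deg j) %/ m)%Z) else 0.
Proof. exact: coord_sum. Qed.

Lemma coord_regrade_deg f r j :
  coord X j (regrade f (deg j + r * m%:Z)) = coord X j (f r).
Proof.
by rewrite coord_regrade [deg j + _]addrC addrK dvdz_mull // mulzK // -lt0n.
Qed.

Lemma regrade_linear : linear regrade.
Proof.
move=> a f h; apply: loopP => n; apply: coord_inj => i.
rewrite loopDE loopZE coordP !coord_regrade; case: ifP => _.
  by rewrite loopDE loopZE coordP.
by rewrite mulr0 addr0.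
Qed.

HB.instance Definition _ :=
  GRing.isLinear.Build K (loop g) (loop g) *:%R regrade regrade_linear.

Lemma regrade_inj : injective regrade.
Proof.
move=> f h fh; apply: loopP => r; apply: coord_inj => i.
by rewrite -[LHS]coord_regrade_deg fh coord_regrade_deg.
Qed.

Lemma regrade_mono k r x : homogeneous deg k x ->
  regrade (mono r x) = mono (k + r * m%:Z) x.
Proof.
have m0 : m%:Z != 0 by rewrite -lt0n.
move=> xk; apply: loopP => n; apply: coord_inj => i.
rewrite coord_regrade !monoE !(fun_if (coord X i)) linear0.
have [->|/xk ->] := eqVneq (coord X i x) 0; first by rewrite !if_same.
have [->|nk] := eqVneq n (k + r * m%:Z).
  by rewrite [k + _]addrC addrK dvdz_mull // mulzK // eqxx.
case: ifP => // mn; case: eqP => // rE; move: nk.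
by rewrite -rE divzK // addrC subrK eqxx.
Qed.

Hypothesis deg_bracket : forall i j,
  homogeneous deg (deg i + deg j) ⟦X`_i, X`_j⟧.

Lemma regrade_bracket f h : regrade ⟦f, h⟧ = ⟦regrade f, regrade h⟧.
Proof.
pose P f := forall h, regrade ⟦f, h⟧ = ⟦regrade f, regrade h⟧.
suff : P f by apply.
apply: loop_span => [|i r _ {}h].
  split=> [h'|a f1 f2 IH1 IH2 h']; first by rewrite bracket0l raddf0 bracket0l.
  by rewrite bracketPl !linearP /= bracketPl IH1 IH2.
pose Q h := regrade ⟦mono r X`_i, h⟧ = ⟦regrade (mono r X`_i), regrade h⟧.
suff : Q h by [].
apply: loop_span => [|j s _].
  split=> [|a f1 f2 IH1 IH2]; first by rewrite /Q bracket0r raddf0 bracket0r.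
  by rewrite /Q bracketPr !linearP /= IH1 IH2.
rewrite /Q bracket_mono (regrade_mono _ (@deg_bracket i j)).
rewrite !(regrade_mono _ (@homogeneous_elem _ _ _)) bracket_mono; congr mono.
by rewrite mulrDl addrACA.
Qed.

Fact ungrade_subproof f :
  (fun r : int => \sum_i coord X i (f (deg i + r * m%:Z)) *: X`_i)
    \in @finsupp_pred K g.
Proof.
apply/asboolP; apply: (@sub_finite_set _ _
  [set ((n - deg i) %/ m)%Z | i in [set: 'I_N] & n in [set r | f r !=
    0]]%classic).
  move=> r /= r0; apply: contrapT => nP; move/eqP: r0; apply.
  apply: big1 => i _.
  have [->|fn] := eqVneq (f (deg i + r * m%:Z)) 0; first
    by rewrite linear0 scale0r.
  case: nP; exists i => //; exists (deg i + r * m%:Z) => //.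
  by rewrite [deg i + _]addrC addrK mulzK // -lt0n.
by apply: finite_image2; [exact: finite_finset | exact: loop_finite].
Qed.

(** A left inverse of [regrade], which forgets the terms [X_i ⊗ t^n] with [n]
    not congruent to [deg i] modulo [m]. *)
Definition ungrade f : loop g := Loop (ungrade_subproof f).

Lemma coord_ungrade f r j : coord X j (ungrade f r) =
  coord X j (f (deg j + r * m%:Z)).
Proof. exact: coord_sum. Qed.

(** The congruence describes the image of [regrade]; in [sigma_loop_fixed] it turns out to be
    invariance under [sigma]. *)
Lemma ungradeK f : (forall n i, coord X i (f n) != 0 -> (m %| n - deg i)%Z) ->
  regrade (ungrade f) = f.
Proof.
move=> fP; apply: loopP => n; apply: coord_inj => i; rewrite coord_regrade.
case: ifP => [mn|/negbT mn]; first
  by rewrite coord_ungrade divzK // addrC subrK.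
by apply/esym/eqP; apply: contraNT mn => /fP.
Qed.

End Regrade.

(** * Weights *)

Section ChevalleyBasis.
Variables (K : numFieldType) (g : finLieAlgType K) (D : cartanDatum g).
Hypothesis D_root : is_root_datum D.
Hypothesis D_chevalley : is_chevalley_basis D.
Implicit Types a b c : 'rV[int]_(rank D).

Local Notation H := (csa D).

Definition chev_seq : seq g :=
  [seq coroot (simple_coords i) | i <- enum 'I_(rank D)]
    ++ [seq rvec c | c <- roots D].

Definition chev_tuple : (size chev_seq).-tuple g := in_tuple chev_seq.

Local Notation X := chev_tuple.
Local Notation I := 'I_(size chev_seq).

Definition chev_weight (i : I) : 'rV[int]_(rank D) :=
  if (i < rank D)%N then 0 else (roots D)`_(i - rank D).

Lemma chev_basis : basis_of fullv X.
Proof. by case: D_chevalley. Qed.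

Variant chev_spec (i : I) : Prop :=
| ChevCoroot (j : 'I_(rank D)) of
    X`_i = coroot (simple_coords j) & chev_weight i = 0
| ChevRoot of chev_weight i \in roots D & X`_i = rvec (chev_weight i).

Lemma size_coroots :
  size [seq coroot (@simple_coords K g D i) | i <- enum 'I_(rank D)] = rank D.
Proof. by rewrite size_map size_enum_ord. Qed.

Lemma chevP i : chev_spec i.
Proof.
have [ir|ir] := ltnP i (rank D).
  apply: (@ChevCoroot _ (Ordinal ir)); last by rewrite /chev_weight ir.
  rewrite /= nth_cat size_coroots ir (nth_map (Ordinal ir)) ?size_enum_ord //.
  by congr (coroot (simple_coords _)); apply: val_inj; rewrite /= nth_enum_ord.
have irs : (i - rank D < size (roots D))%N.
  rewrite -(ltn_add2l (rank D)) subnKC //; apply: leq_trans (ltn_ord i) _.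
  by rewrite size_cat size_coroots size_map.
apply: ChevRoot; rewrite /chev_weight ltnNge ir /= ?mem_nth //.
by rewrite nth_cat size_coroots ltnNge ir /= (nth_map 0).
Qed.

Lemma chev_coroot_index (j : 'I_(rank D)) :
  exists2 i : I, X`_i = coroot (simple_coords j) & chev_weight i = 0.
Proof.
have ji : (j < size chev_seq)%N.
  by rewrite /chev_seq size_cat size_coroots ltn_addr.
exists (Ordinal ji); last by rewrite /chev_weight /= ltn_ord.
rewrite /= nth_cat size_coroots ltn_ord (nth_map j) ?size_enum_ord //.
by rewrite nth_ord_enum.
Qed.

Lemma chev_root_index c : c \in roots D ->
  exists2 i : I, X`_i = rvec c & chev_weight i = c.
Proof.
move=> rc; have ci : (rank D + index c (roots D) < size chev_seq)%N.
  by rewrite /chev_seq size_cat size_coroots size_map ltn_add2l index_mem.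
exists (Ordinal ci); last first.
  by rewrite /chev_weight /= ltnNge leq_addr /= addKn nth_index.
rewrite /= nth_cat size_coroots ltnNge leq_addr /= addKn (nth_map 0) ?index_mem
  //.
by rewrite nth_index.
Qed.

Local Notation homog := (homogeneous X chev_weight).

Lemma homog_root c : c \in roots D -> homog c (rvec c).
Proof.
by move=> /chev_root_index[i <- <-]; apply: homogeneous_elem; exact: chev_basis.
Qed.

Lemma homog_csa h : h \in H -> homog 0 h.
Proof.
apply: csa_ind => // [k x y||j]; first exact: homogeneousP.
  exact: homogeneous0.
by have [i <- <-] := chev_coroot_index j; apply: homogeneous_elem;
  exact: chev_basis.
Qed.

Lemma chev_ad_csa (i : I) (h : subvs_of H) :
  ⟦vsval h, X`_i⟧ = (root_eval (chev_weight i) h : K) *: X`_i.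
Proof.
have [j -> ->|rc ->] := chevP i; last exact: rvec_weight.
rewrite root_eval0 lfunE scale0r (csa_abelian D_root) ?subvsP //.
by rewrite coroot_csa // simple_in_roots.
Qed.

Lemma coord_ad_csa i (h : subvs_of H) (x : g) :
  coord X i ⟦vsval h, x⟧ = (root_eval (chev_weight i) h : K) * coord X i x.
Proof.
rewrite {1}[x](coord_full chev_basis) raddf_sum.
rewrite (eq_bigr (fun j => (coord X j x * (root_eval (chev_weight j) h : K)) *:
  X`_j)).
  by rewrite coord_sum ?chev_basis // mulrC.
by move=> j _; rewrite [LHS]bracketZr chev_ad_csa scalerA.
Qed.

Lemma homog_bracket (i j : I) :
  homog (chev_weight i + chev_weight j) ⟦X`_i, X`_j⟧.
Proof.
have [k iE wi|ri iE] := chevP i.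
  have kH : X`_i \in H by rewrite iE coroot_csa // simple_in_roots.
  rewrite wi add0r -[X`_i](vsprojK kH) chev_ad_csa.
  by apply: homogeneousZ; apply: homogeneous_elem; exact: chev_basis.
have [k jE wj|rj jE] := chevP j.
  have kH : X`_j \in H by rewrite jE coroot_csa // simple_in_roots.
  rewrite wj addr0 bracketC -[X`_j](vsprojK kH) chev_ad_csa -scaleNr.
  by apply: homogeneousZ; apply: homogeneous_elem; exact: chev_basis.
rewrite iE jE; have [ij0|ij0] := eqVneq (chev_weight i + chev_weight j) 0.
  rewrite ij0; move/eqP: ij0; rewrite addrC addr_eq0 => /eqP->.
  exact/homog_csa/coroot_csa.
have [rij|rij] := boolP (chev_weight i + chev_weight j \in roots D).
  have [n _ ->] := bracket_rvec_root D_root D_chevalley ri rj rij.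
  exact/homogeneousZ/homog_root.
rewrite bracket_rvec0 //; exact: homogeneous0.
Qed.

End ChevalleyBasis.

Section AffineWeights.
Variables (K : numFieldType) (g : finLieAlgType K) (D : cartanDatum g).
Hypothesis D_root : is_root_datum D.
Hypothesis D_chevalley : is_chevalley_basis D.
Implicit Types (b c : 'rV[int]_(rank D)) (a : 'rV[int]_(rank D).+1).

Local Notation H := (csa D).
Local Notation X := (chev_tuple D).
Local Notation wt := (@chev_weight K g D).

(** The coefficient [b] in [a = b + (a 0 ord0) delta]. *)
Definition fin_part a : 'rV[int]_(rank D) :=
  (\row_j a 0 (lift ord0 j)) - theta D *~ a 0 ord0.

Lemma rowMz n (v : 'rV[int]_n) (r : int) i : (v *~ r) 0 i = v 0 i * r.
Proof. by rewrite -scaler_int mxE intz mulrC. Qed.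

Lemma fin_to_affE c j : @fin_to_aff K g D c 0 (lift ord0 j) = c 0 j.
Proof. by rewrite mxE liftK. Qed.

Lemma fin_to_aff0 c : @fin_to_aff K g D c 0 ord0 = 0.
Proof. by rewrite mxE unlift_none. Qed.

Lemma imag_rootE j : imag_root D 0 (lift ord0 j) = theta D 0 j.
Proof.
by rewrite /imag_root mxE fin_to_affE /aff_simple mxE eqxx eq_sym (negPf
  (neq_lift _ _)) add0r.
Qed.

Lemma imag_root0 : imag_root D 0 ord0 = 1.
Proof. by rewrite /imag_root mxE fin_to_aff0 /aff_simple mxE !eqxx addr0. Qed.

Lemma fin_partE a j : fin_part a 0 j =
  a 0 (lift ord0 j) - theta D 0 j * a 0 ord0.
Proof. by rewrite !mxE rowMz. Qed.

Lemma aff_decomp a :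
  a = fin_to_aff (fin_part a) + imag_root D *~ a 0 ord0.
Proof.
apply/rowP=> i; rewrite mxE rowMz; case: (unliftP ord0 i) => [j ->|->].
  by rewrite fin_to_affE imag_rootE fin_partE subrK.
by rewrite fin_to_aff0 imag_root0 add0r mul1r.
Qed.

Lemma fin_part_affine c r : fin_part (fin_to_aff c + imag_root D *~ r) = c.
Proof.
have r0 : (fin_to_aff c + imag_root D *~ r) 0 ord0 = r.
  by rewrite mxE rowMz fin_to_aff0 imag_root0 add0r mul1r.
apply/rowP=> j; rewrite fin_partE r0 mxE fin_to_affE rowMz imag_rootE.
by rewrite addrK.
Qed.

Lemma dual_mulrz (f : dualv H) (r : int) h : (f *~ r) h = (f h : K) * r%:~R.
Proof. by rewrite -scaler_int scale_lfunE [LHS]mulrC. Qed.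

Lemma aff_evalE a (h : subvs_of H) (w : K) :
  aff_eval a h w = (root_eval (fin_part a) h : K) + w * (a 0 ord0)%:~R.
Proof.
rewrite /aff_eval big_ord_recl /aff_simple_eval unlift_none.
have -> : (root_eval (fin_part a) h : K) =
    \sum_(j < rank D) (simple_root j h : K) * (a 0 (lift ord0 j))%:~R -
    (root_eval (theta D) h : K) * (a 0 ord0)%:~R.
  rewrite /root_eval !sum_lfunE mulr_suml -sumrB; apply: eq_bigr => j _.
  by rewrite !dual_mulrz fin_partE rmorphB rmorphM /= mulrBr mulrA.
under eq_bigr do rewrite liftK -mulrzr.
by rewrite -mulrzr mulrBl addrC addrA addrAC.
Qed.

(** Evaluation at d isolates the coefficient of delta, and evaluation on the finite Cartan
    subalgebra the finite part, because the simple roots are independent. *)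
Lemma aff_eval_inj b (r : int) a :
  (forall (h : subvs_of H) (w : K), (root_eval b h : K) + w * r%:~R =
    aff_eval a h w) ->
  r = a 0 ord0 /\ b = fin_part a.
Proof.
move=> abE; have := abE 0 1; rewrite aff_evalE !linear0 !add0r !mul1r.
move=> /eqP; rewrite eqr_int => /eqP ra; split=> //.
apply: (root_eval_inj D_root); apply/lfunP => h.
by have := abE h 0; rewrite aff_evalE !mul0r !addr0.
Qed.

Lemma bracket_mono0 (x : g) (f : loop g) r : ⟦mono 0 x, f⟧ r = ⟦x, f r⟧.
Proof.
elim/loop_ind: f => [|f1 f2 IH1 IH2|s y]; first by rewrite bracket0r bracket0r.
  by rewrite bracketDr !loopDE IH1 IH2 bracketDr.
by rewrite bracket_mono add0r !monoE; case: eqP; rewrite // bracket0r.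
Qed.

Lemma loop_part_csa (h : subvs_of H) (z w : K) (Y : affine D) :
  loop_part ⟦aff_cartan h z w, Y⟧ =
  ⟦mono 0 (vsval h), loop_part Y⟧ + w *: tdt (loop_part Y).
Proof.
rewrite [Y]affineE /aff_cartan aff_bracketE /loop_part /= tdt_mono.
by rewrite scale0r scaler0 subr0.
Qed.

Lemma coord_loop_part_csa i (h : subvs_of H) (z w : K) (Y : affine D) r :
  coord X i (loop_part ⟦aff_cartan h z w, Y⟧ r) =
  ((root_eval (wt i) h : K) + w * r%:~R) * coord X i (loop_part Y r).
Proof.
rewrite loop_part_csa loopDE addrC loopZE coordP bracket_mono0 coord_ad_csa //.
rewrite -[tdt _ r]/(r%:~R *: loop_part Y r) linearZ /=.
by rewrite mulrA -mulrDl addrC.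
Qed.

Lemma loop_weight_coord a (f : loop g) i r : loop_weight_space a f ->
  coord X i (f r) != 0 -> r = a 0 ord0 /\ wt i = fin_part a.
Proof.
move=> fa fir; apply: aff_eval_inj => h w; apply: (mulIf fir).
have := coord_loop_part_csa i h 0 w (aff D f 0 0) r; rewrite fa => <-.
by rewrite loopZE linearZ.
Qed.

Lemma aff_root_loop_weight a Y :
  aff_root_space a Y -> loop_weight_space a (loop_part Y).
Proof.
move=> Ya h z w; rewrite loop_part_csa.
by rewrite -[LHS](loop_part_csa h z w Y) Ya.
Qed.

Lemma loop_weight_mono i r :
  loop_weight_space (fin_to_aff (wt i) + imag_root D *~ r) (mono r X`_i).
Proof.
move=> h z w; rewrite loop_part_csa /loop_part /= bracket_mono add0r.
rewrite chev_ad_csa // tdt_mono linearZ /= aff_evalE fin_part_affine.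
rewrite mxE rowMz fin_to_aff0 imag_root0 add0r mul1r.
by rewrite scalerA -scalerDl.
Qed.

End AffineWeights.

(** * The parabolic subalgebra *)

Section Parabolic.
Variables (K : numFieldType) (g : finLieAlgType K) (D : cartanDatum g).
Hypothesis D_root : is_root_datum D.
Hypothesis D_chevalley : is_chevalley_basis D.
Variables (J : {set 'I_(rank D).+1}) (m : nat).
Hypothesis m_gt0 : (0 < m)%N.
Hypothesis m_def : m%:Z = gr J (imag_root D).
Implicit Types (b c : 'rV[int]_(rank D)) (a : 'rV[int]_(rank D).+1).

Local Notation H := (csa D).
Local Notation X := (chev_tuple D).
Local Notation wt := (@chev_weight K g D).

(** * Degrees of finite roots *)

Definition fin_gr c : int := gr J (fin_to_aff c).

Lemma grD a a' : gr J (a + a') = gr J a + gr J a'.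
Proof. by rewrite -big_split; apply: eq_bigr => i _; rewrite mxE. Qed.

Lemma grMz a r : gr J (a *~ r) = gr J a * r.
Proof. by rewrite mulr_suml; apply: eq_bigr => i _; rewrite rowMz. Qed.

Lemma grN a : gr J (- a) = - gr J a.
Proof. by rewrite /gr -sumrN; apply: eq_bigr => i _; rewrite mxE. Qed.

Lemma fin_to_affD b c : fin_to_aff (b + c) = fin_to_aff b + fin_to_aff c.
Proof.
by apply/rowP=> i; rewrite !mxE; case: (unlift _ _) => [j|];
  rewrite ?mxE ?addr0.
Qed.

Lemma fin_to_affN c : fin_to_aff (- c) = - fin_to_aff c.
Proof.
by apply/rowP=> i; rewrite !mxE; case: (unlift _ _) => [j|];
  rewrite ?mxE ?oppr0.
Qed.

Lemma fin_grD b c : fin_gr (b + c) = fin_gr b + fin_gr c.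
Proof. by rewrite /fin_gr fin_to_affD grD. Qed.

Lemma fin_grN c : fin_gr (- c) = - fin_gr c.
Proof.
by rewrite /fin_gr fin_to_affN grN.
Qed.

Lemma fin_gr0 : fin_gr 0 = 0.
Proof. by rewrite -(subrr (0 : 'rV_(rank D))) fin_grD fin_grN subrr. Qed.

Lemma gr_affine c r : gr J (fin_to_aff c + imag_root D *~ r) =
  fin_gr c + r * m%:Z.
Proof. by rewrite grD grMz -m_def [_ * r]mulrC. Qed.

Lemma gr_fin_part a : gr J a = fin_gr (fin_part a) + a 0 ord0 * m%:Z.
Proof. by rewrite {1}[a]aff_decomp gr_affine. Qed.

Lemma gr_simple i : gr J (@aff_simple K g D i) = (s_exp J i)%:Z.
Proof.
rewrite /s_exp /gr; have [iJ|iJ] := boolP (i \in J).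
  apply: big1 => j jJ; rewrite mxE eqxx /=.
  by case: eqP => // ji; rewrite ji iJ in jJ.
rewrite (bigD1 i) //= big1 => [|j /andP[_ ji]]; first
  by rewrite mxE !eqxx addr0.
by rewrite mxE eqxx (negPf ji).
Qed.

Lemma fin_gr_simple i : fin_gr (simple_coords i) = (s_exp J (lift ord0 i))%:Z.
Proof.
rewrite -gr_simple; congr gr; apply/rowP=> j;
  rewrite /aff_simple [RHS]mxE eqxx /=.
case: (unliftP ord0 j) => [k ->|->]; last
  by rewrite fin_to_aff0 (negPf (neq_lift _ _)).
by rewrite fin_to_affE mxE eqxx (inj_eq (@lift_inj _ _)).
Qed.

Lemma m_theta : m%:Z = (s_exp J ord0)%:Z + fin_gr (theta D).
Proof. by rewrite m_def /imag_root grD gr_simple. Qed.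

Lemma fin_gr_ge0 c : nonneg_coords c -> 0 <= fin_gr c.
Proof.
move=> /nonneg_coordsP cP; apply: sumr_ge0 => i _.
by case: (unliftP ord0 i) => [j ->|->]; rewrite ?fin_to_affE ?fin_to_aff0.
Qed.

Lemma fin_gr_theta c : c \in roots D -> fin_gr c <= fin_gr (theta D).
Proof.
by move=> /(theta_max D_root)/fin_gr_ge0; rewrite fin_grD fin_grN subr_ge0.
Qed.

(** Since delta = alpha_0 + theta, m is at least the degree of theta, which dominates that of every
    root. So all terms with r > 0 have nonnegative degree and those with r < -1 have none. *)
Lemma fin_gr_root c : c \in roots D -> `|fin_gr c| <= m%:Z.
Proof.
move=> rc; rewrite ler_norml lerNl -fin_grN m_theta.
have le d : d \in roots D -> fin_gr d <= (s_exp J ord0)%:Z + fin_gr (theta D).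
  by move=> /fin_gr_theta rd; apply: le_trans rd _; rewrite lerDr.
by rewrite !le // rootsN.
Qed.

Definition chev_deg i : int := fin_gr (wt i).

Lemma chev_deg_bracket i j :
  homogeneous X chev_deg (chev_deg i + chev_deg j) ⟦X`_i, X`_j⟧.
Proof.
move=> k /(homog_bracket D_root D_chevalley) kij.
by rewrite /chev_deg kij fin_grD.
Qed.

(** * The parabolic subalgebra has only nonnegative degrees *)

Definition nonneg_degree (f : loop g) : Prop :=
  forall i r, coord X i (f r) != 0 -> 0 <= chev_deg i + r * m%:Z.

Local Notation regr := (regrade X chev_deg m).

(** This makes nonnegative degree the preimage of the current algebra under a morphism, so closure
    under the bracket is inherited. *)
Lemma nonneg_degreeP f : nonneg_degree f <-> current_set (regr f).
Proof.
split=> [fP n n0|fP i r fir].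
  apply: (coord_inj (chev_basis D_chevalley)) => i; rewrite linear0.
  rewrite (coord_regrade (chev_basis D_chevalley)).
  case: ifP => // mn; apply/eqP; rewrite -[_ == 0]negbK; apply/negP => /fP.
  by rewrite divzK // addrC subrK leNgt n0.
rewrite leNgt; apply: contra fir => /fP fn.
by rewrite -(coord_regrade_deg (chev_basis D_chevalley) chev_deg m_gt0) fn
  linear0.
Qed.

Lemma is_subalgebra_nonneg_degree : is_subalgebra nonneg_degree.
Proof.
have [[c0 cD] cL] := @is_subalgebra_current K g.
split; first split=> [i r|a f h /nonneg_degreeP f0 /nonneg_degreeP h0].
- by rewrite loop0E linear0 eqxx.
- apply/nonneg_degreeP; rewrite regrade_linear ?chev_basis //;
  exact: (cD _ _ _ f0 h0).
move=> f h /nonneg_degreeP f0 /nonneg_degreeP h0; apply/nonneg_degreeP.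
rewrite (regrade_bracket (chev_basis D_chevalley) m_gt0 chev_deg_bracket).
exact: (cL _ _ f0 h0).
Qed.

Lemma nonneg_degree_tdt f : nonneg_degree f -> nonneg_degree (tdt f).
Proof.
move=> fP i r; rewrite -[tdt f r]/(r%:~R *: f r) linearZ /= mulf_eq0 negb_or.
by move=> /andP[_ /fP].
Qed.

Lemma nonneg_degree_borel (Y : affine D) : borel Y ->
  nonneg_degree (loop_part Y).
Proof.
move=> [Yneg Y0] i r; have [r0|r0|->] := ltgtP r 0.
- by rewrite Yneg // linear0 eqxx.
- move=> _; rewrite addrC -lerBlDr sub0r.
  have rm : m%:Z <= r * m%:Z by rewrite ler_peMl // gtz0_ge1.
  apply: le_trans rm; rewrite /chev_deg -fin_grN.
  have [j _ ->|rw _] := chevP i; first by rewrite oppr0 fin_gr0.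
  by apply: le_trans (fin_gr_root (rootsN D_root D_chevalley rw));
    apply: ler_norm.
rewrite mul0r addr0 /chev_deg; move/memv_addP: Y0 => [h hH [v vV ->]].
apply: contraNT; rewrite -ltNge linearD /= => ineg.
have coord0 (x : g) w : homogeneous X wt w x -> 0 <= fin_gr w ->
  coord X i x = 0.
  by move=> xw w0; apply/eqP; apply: contraTT ineg => /xw ->; rewrite -leNgt.
rewrite (coord0 _ _ (homog_csa D_chevalley hH)) ?fin_gr0 // add0r.
rewrite [v](coord_span (X := in_tuple _) vV) linear_sum big1 // => k _.
rewrite linearZ /=; have /mapP[c] := mem_nth 0 (ltn_ord k).
rewrite mem_filter => /andP[c0 rc] ->.
by rewrite (coord0 _ _ (homog_root D_chevalley rc)) ?mulr0 // fin_gr_ge0.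
Qed.

Lemma nonneg_degree_simple j (Y : affine D) : j \in J ->
  aff_root_space (- aff_simple j) Y -> nonneg_degree (loop_part Y).
Proof.
move=> jJ /aff_root_loop_weight Yw i r ir.
have [rE wE] := loop_weight_coord D_root D_chevalley Yw ir.
rewrite rE /chev_deg wE -gr_fin_part.
by rewrite grN gr_simple /s_exp jJ oppr0.
Qed.

(** Minimality of the generated subalgebra. The affine bracket adds terms in t d/dt coming from d,
    which only rescale coefficients. *)
Lemma parabolic_nonneg_degree (Y : affine D) :
  parabolic J Y -> nonneg_degree (loop_part Y).
Proof.
have [[n0 nP] nL] := is_subalgebra_nonneg_degree.
move=> /(_ (fun Z => nonneg_degree (loop_part Z))); apply; split; last first.
  by move=> Z [/nonneg_degree_borel|[j]] //; exact: nonneg_degree_simple.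
split; first split=> // k Z Z'; first exact: nP.
move=> Z Z' nZ nZ'; rewrite [Z]affineE [Z']affineE aff_bracketE.
have nS : is_subspace nonneg_degree by [].
rewrite [loop_part _]/(_ - _) -scaleNr.
apply: (is_subspaceD nS); last by apply: (is_subspaceZ _ nS);
  exact: nonneg_degree_tdt.
apply: (is_subspaceD nS); first exact: nL.
by apply: (is_subspaceZ _ nS); exact: nonneg_degree_tdt.
Qed.

(** * Generation of the terms of nonnegative degree *)

Lemma loop_part_aff (f : loop g) z w : loop_part (aff D f z w) = f.
Proof. by []. Qed.

Definition parabolic_mono r (x : g) : Prop :=
  parabolic J (aff D (mono r x) 0 0).

Lemma parabolic_gen (Y : affine D) : borel Y \/
  (exists2 j, j \in J & aff_root_space (- aff_simple j) Y) -> parabolic J Y.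
Proof. by move=> BY; apply: sub_gen_smallest. Qed.

(** The Borel subalgebra contains c and d, so membership depends on the loop alone and the cocycle
    can be ignored. *)
Lemma parabolic_shift (f : loop g) z w z' w' :
  parabolic J (aff D f z w) -> parabolic J (aff D f z' w').
Proof.
have [pS _] := lieSubalgP (parabolic J); move=> pf.
have -> : aff D f z' w' = aff D f z w + aff D 0 (z' - z) (w' - w).
  by congr (_, _, _); rewrite /= ?addr0 // addrC subrK.
apply: (is_subspaceD pS) => //; apply: parabolic_gen; left.
by split=> //; rewrite mem0v.
Qed.

Lemma parabolic_bracket r s x y : parabolic_mono r x ->
  parabolic_mono s y -> parabolic_mono (r + s) ⟦x, y⟧.
Proof.
have [_ pL] := lieSubalgP (parabolic J).
move=> px py; have := pL _ _ px py; rewrite aff_bracketE !scale0r addr0 subr0.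
by rewrite bracket_mono; apply: parabolic_shift.
Qed.

Lemma parabolicZ r (k : K) x : parabolic_mono r x -> parabolic_mono r (k *: x).
Proof.
have [pS _] := lieSubalgP (parabolic J).
move=> /(is_subspaceZ k pS); rewrite /parabolic_mono.
have -> : aff D (mono r (k *: x)) 0 0 = k *: aff D (mono r x) 0 0.
  by congr (_, _, _); rewrite /= ?scaler0 // linearZ.
by [].
Qed.

Lemma parabolic_borel0 x : x \in fin_borel D -> parabolic_mono 0 x.
Proof.
move=> xB; apply: parabolic_gen; left; split=> [r r0|];
  rewrite loop_part_aff monoE //.
by case: eqP r0 => // ->; rewrite ltxx.
Qed.

Lemma parabolic_pos r x : 0 < r -> parabolic_mono r x.
Proof.
move=> r0; apply: parabolic_gen; left; split=> [s s0|];
  rewrite loop_part_aff monoE.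
  by case: eqP s0 => // ->; rewrite lt_gtF.
by case: eqP r0 => [<-|_]; rewrite ?ltxx ?mem0v.
Qed.

Lemma parabolic_bracket_root r s b c : b \in roots D -> c \in roots D ->
  b + c \in roots D ->
  parabolic_mono r (rvec b) -> parabolic_mono s (rvec c) ->
    parabolic_mono (r + s) (rvec (b + c)).
Proof.
move=> ra rb rab pa pb; have := parabolic_bracket pa pb.
have [n n0 ->] := bracket_rvec_root D_root D_chevalley ra rb rab.
by move=> /(parabolicZ n^-1); rewrite scalerA mulVf // scale1r.
Qed.

Lemma aff_root_mono i r :
  aff_root_space (fin_to_aff (wt i) + imag_root D *~ r) (aff D (mono r X`_i) 0
    0).
Proof.
move=> h z w; have := loop_weight_mono D_root D_chevalley i r h z w.
rewrite /aff_cartan aff_bracketE cocycle_mono mul0r if_same loop_part_aff => ->.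
by congr (_, _, _); rewrite /= scaler0.
Qed.

Lemma parabolic_simple j : lift ord0 j \in J ->
  parabolic_mono 0 (rvec (- simple_coords j)).
Proof.
move=> jJ; have rj := rootsN D_root D_chevalley (simple_in_roots D_root j).
have [i <- wi] := chev_root_index rj.
apply: parabolic_gen; right; exists (lift ord0 j) => //.
have -> : - aff_simple (lift ord0 j) = fin_to_aff (wt i) + imag_root D *~ 0.
  rewrite wi mulr0z addr0 fin_to_affN; congr (- _); apply/rowP=> k.
  rewrite mxE eqxx /=; case: (unliftP ord0 k) => [l ->|->].
    by rewrite fin_to_affE mxE eqxx (inj_eq (@lift_inj _ _)).
  by rewrite fin_to_aff0 (negPf (neq_lift _ _)).
exact: aff_root_mono.
Qed.

Lemma parabolic_theta : ord0 \in J -> parabolic_mono (-1) (rvec (theta D)).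
Proof.
move=> J0; have [i <- wi] := chev_root_index (theta_root D_root).
apply: parabolic_gen; right; exists ord0 => //.
have -> : - aff_simple ord0 = fin_to_aff (wt i) + imag_root D *~ (-1).
  by rewrite wi mulrNz mulr1z /imag_root opprD addrCA subrr addr0.
exact: aff_root_mono.
Qed.

Lemma simple_in_J j : fin_gr (simple_coords j) <= 0 -> lift ord0 j \in J.
Proof. by rewrite fin_gr_simple /s_exp; case: (_ \in J). Qed.

(** Degrees of simple roots are 0 or 1, so degree 0 forces every simple root met while building c
    into J; x_(-c) is then an iterated bracket of the corresponding generators. *)
Lemma parabolic_neg_root c : c \in roots D -> nonneg_coords c ->
  fin_gr c <= 0 ->
  parabolic_mono 0 (rvec (- c)).
Proof.
move: c; apply: (pos_root_ind D_root D_chevalley) => [j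
  /simple_in_J/parabolic_simple//|].
move=> c j rc c0 rcj IH; rewrite fin_grD => cj.
have j0 : 0 <= fin_gr (simple_coords j) by rewrite fin_gr_simple.
have cj0 := fin_gr_ge0 c0.
rewrite opprD -[0]addr0; apply: parabolic_bracket_root;
  rewrite -?opprD ?mem_rootsN //.
- exact: simple_in_roots.
- by apply: IH; apply: (le_trans _ cj); rewrite lerDl.
- by apply: parabolic_simple; apply: simple_in_J; apply: (le_trans _ cj);
  rewrite lerDr.
Qed.

(** From gr c >= m = s_0 + gr theta and gr theta >= gr c follow s_0 = 0, which puts 0 in J, and gr c
    = gr theta. So the chain from theta down to c subtracts only simple roots in J. It cannot end at
    a negative simple root, whose degree is at most 0 < m. *)
Lemma parabolic_top_root c : c \in roots D -> m%:Z <= fin_gr c ->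
  parabolic_mono (-1) (rvec c).
Proof.
have J0 d : d \in roots D -> m%:Z <= fin_gr d -> ord0 \in J.
  move=> /fin_gr_theta rd dm; move: (le_trans dm rd).
  by rewrite m_theta /s_exp gerDr; case: (_ \in J).
move: c; apply: (root_descent_ind D_root D_chevalley).
- by move=> /(J0 _ (theta_root D_root)); exact: parabolic_theta.
- move=> j; rewrite fin_grN fin_gr_simple => mj; exfalso; move: mj.
  by rewrite leNgt (le_lt_trans (_ : _ <= 0)) // oppr_le0.
move=> c j rc rcj IH cm.
have jJ : fin_gr (simple_coords j) <= 0.
  rewrite -(gerDl (fin_gr c)) -fin_grD; apply: (le_trans _ cm).
  have := fin_gr_theta rcj => /le_trans; apply.
  by rewrite m_theta lerDr.
have j0 : 0 <= fin_gr (simple_coords j) by rewrite fin_gr_simple.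
rewrite -[c](addrK (simple_coords j)) -[-1]addr0.
apply: parabolic_bracket_root; rewrite ?addrK ?mem_rootsN //.
- exact: simple_in_roots.
- by apply: IH; rewrite fin_grD; apply: le_trans cm _; rewrite lerDl.
- by apply: parabolic_simple; exact: simple_in_J.
Qed.

Lemma parabolic_chev i r : 0 <= chev_deg i + r * m%:Z -> parabolic_mono r X`_i.
Proof.
have [r0|r0|->] := ltgtP r 0; last 2 first.
- by move=> _; exact: parabolic_pos.
- rewrite mul0r addr0 /chev_deg; have [j -> _ _|rw ->] := chevP i.
    apply: parabolic_borel0; apply: (subvP (addvSl _ _)).
    by apply: coroot_csa => //; exact: simple_in_roots.
  have /orP[pw _|nw dw] := root_pos_or_neg D_root rw.
    apply: parabolic_borel0; apply: (subvP (addvSr _ _)); apply/memv_span/map_f.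
    by rewrite mem_filter pw.
  rewrite -[wt i]opprK; apply: parabolic_neg_root; rewrite ?mem_rootsN //.
  by rewrite fin_grN oppr_le0.
rewrite /chev_deg; have [j _ ->|rw ->] := chevP i => dw.
  by move: dw; rewrite fin_gr0 add0r leNgt pmulr_llt0 ?r0.
have [s rE] : exists s : nat, r = - s.+1%:Z.
  by case: (r) r0 => // s _; exists s; rewrite NegzE.
have dm : m%:Z <= s.+1%:Z * m%:Z by rewrite ler_peMl.
move: dw; rewrite rE mulNr subr_ge0 => dw.
have := fin_gr_root rw; rewrite ler_norml => /andP[_ wm].
(* With r = - (s + 1), nonnegative degree gives (s + 1) m <= gr c <= m. *)
have s0 : s = 0%N.
  have : s.+1%:Z * m%:Z <= 1 * m%:Z by rewrite mul1r (le_trans dw).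
  by rewrite ler_pM2r // lez_nat; case: (s).
rewrite s0; apply: parabolic_top_root => //; exact: le_trans dm dw.
Qed.

(** A simple coroot times t^r is the bracket of x_j with x_(-j) t^r; a root vector is half its
    bracket with its own coroot, as c(h_c) = 2. Intersecting with the derived algebra thus only
    removes the d-direction. *)
Lemma derived_chev (i : 'I_(size (chev_seq D))) r :
  exists z, derived (affine D) (aff D (mono r X`_i) z 0).
Proof.
have dP Y Z : derived (affine D) ⟦Y, Z⟧ by apply: sub_gen_smallest; exists Y, Z.
have [j -> _|rw ->] := chevP i.
  exists (cocycle D (mono 0 (rvec (simple_coords j))) (mono r (rvec (-
    simple_coords j)))).
  have := dP (aff D (mono 0 (rvec (simple_coords j))) 0 0)
             (aff D (mono r (rvec (- simple_coords j))) 0 0).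
  by rewrite aff_bracketE !scale0r subr0 addr0 bracket_mono add0r.
exists 0; have hH := coroot_csa D_chevalley rw.
have [dS _] := lieSubalgP (derived (affine D)).
have := is_subspaceZ 2%:R^-1 dS (dP (aff D (mono 0 (coroot (wt i))) 0 0)
  (aff D (mono r (rvec (wt i))) 0 0)).
rewrite aff_bracketE cocycle_mono mul0r if_same !scale0r subr0 addr0
  bracket_mono add0r.
rewrite -[X in ⟦X, _⟧](vsprojK hH) rvec_weight // root_eval_coroot //.
congr (derived _ _); congr (_, _, _); rewrite /= ?scaler0 //.
by rewrite -linearZ /= scalerA mulVf ?pnatr_eq0 // scale1r.
Qed.

Lemma ptildeP f : ptilde J f <-> nonneg_degree f.
Proof.
split=> [[z [pf _]]|fP]; first exact: (parabolic_nonneg_degree pf).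
have [pS _] := lieSubalgP (ptilde J).
apply: (loop_span (chev_basis D_chevalley) pS) => i r /fP ir.
have [z dz] := derived_chev i r; exists z; split=> //.
exact: parabolic_shift (parabolic_chev ir).
Qed.

End Parabolic.

(** * The isomorphism *)

Lemma prim_root_dvdz (F : fieldType) (m : nat) (z : F) (k : int) :
  m.-primitive_root z -> (m %| k)%Z = (z ^ k == 1).
Proof.
move=> zP; rewrite dvdzE /=; case: k => k; rewrite ?NegzE ?abszN.
  by rewrite (prim_order_dvd zP).
by rewrite (prim_order_dvd zP) -exprnN invr_eq1.
Qed.

Section Isomorphism.
Variables (K : numFieldType) (g : finLieAlgType K) (D : cartanDatum g).
Hypothesis D_root : is_root_datum D.
Hypothesis D_chevalley : is_chevalley_basis D.
Variables (J : {set 'I_(rank D).+1}) (m : nat).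
Hypothesis m_def : m%:Z = gr J (imag_root D).
Variables (xi : K) (sigma : lieHom g g).
Hypothesis xi_prim : m.-primitive_root xi.
Hypothesis sigma_simple : forall i : 'I_(rank D),
  sigma (rvec (simple_coords i)) =
  xi ^+ s_exp J (lift ord0 i) *: rvec (simple_coords i).
Hypothesis sigma_theta :
  sigma (rvec (- theta D)) = xi ^+ s_exp J ord0 *: rvec (- theta D).
Implicit Types (c : 'rV[int]_(rank D)).

Local Notation H := (csa D).
Local Notation X := (chev_tuple D).
Local Notation I := 'I_(size (chev_seq D)).
Local Notation deg := (chev_deg J).
Local Notation regr := (regrade X deg m).
Local Notation Xbasis := (chev_basis D_chevalley).

Let m_gt0 : (0 < m)%N := prim_order_gt0 xi_prim.

Let xi_unit : xi \is a GRing.unit.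
Proof. by rewrite -(unitrX_pos _ m_gt0) (prim_expr_order xi_prim) unitr1. Qed.

Lemma sigma_root c : c \in roots D ->
  sigma (rvec c) = xi ^ fin_gr J c *: rvec c.
Proof.
move=> rc; have rNc := rootsN D_root D_chevalley rc.
(* After negation the descent from theta becomes an ascent from - theta by adding simple roots,
   matching the vectors on which [sigma] is prescribed. *)
rewrite -[c]opprK; move: (- c) rNc {rc} => {c}.
apply: (root_descent_ind D_root D_chevalley) => [|i|c i rc rci IH].
- rewrite sigma_theta fin_grN; congr (_ *: _).
  (* Here s_0 = m - gr theta, and xi^m = 1 removes the m. *)
  have := m_theta m_def => /eqP; rewrite addrC -subr_eq => /eqP <-.
  by rewrite opprB (exprzDr xi_unit) -exprnN (prim_expr_order xi_prim) invr1
    mulr1.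
- by rewrite opprK sigma_simple fin_gr_simple.
have cE : - c = - (c + simple_coords i) + simple_coords i
  by rewrite opprD subrK.
have ri := simple_in_roots D_root i.
have rNci := rootsN D_root D_chevalley rci.
have rNc : - (c + simple_coords i) + simple_coords i \in roots D.
  by rewrite -cE rootsN.
have [n n0 nE] := bracket_rvec_root D_root D_chevalley rNci ri rNc.
have -> : rvec (- c) = n^-1 *:
  ⟦rvec (- (c + simple_coords i)), rvec (simple_coords i)⟧.
  by rewrite nE -cE scalerA mulVf // scale1r.
rewrite linearZ /= lie_morph IH sigma_simple bracketZl bracketZr.
rewrite [RHS]scalerA [_ * n^-1]mulrC -[RHS]scalerA; congr (_ *: _).
rewrite scalerA; congr (_ *: _).
by rewrite cE fin_grD fin_gr_simple (exprzDr xi_unit).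
Qed.

Lemma sigma_chev (i : I) : sigma X`_i = xi ^ deg i *: X`_i.
Proof.
rewrite /chev_deg; have [j -> ->|rw ->] := chevP i; last exact: sigma_root.
have rj := simple_in_roots D_root j.
rewrite fin_gr0 expr0z scale1r /coroot lie_morph !sigma_root ?rootsN //.
rewrite bracketZl bracketZr scalerA -(exprzDr xi_unit).
by rewrite fin_grN subrr scale1r.
Qed.

Lemma coord_sigma i (x : g) : coord X i (sigma x) = xi ^ deg i * coord X i x.
Proof.
rewrite {1}[x](coord_full Xbasis) linear_sum /=.
rewrite (eq_bigr (fun j : I => (coord X j x * xi ^ deg j) *: X`_j)).
  by rewrite (coord_sum Xbasis) mulrC.
by move=> j _; rewrite linearZ /= sigma_chev scalerA.
Qed.

(** The extended [sigma] is diagonal: on X_i t^n it is multiplication by xi^(deg i - n), which is 1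
    exactly when m divides n - deg i, as xi is primitive. *)
Lemma sigma_loop_fixed (f : loop g) :
  sigma_loop xi sigma f = f <->
  forall n i, coord X i (f n) != 0 -> (m %| n - deg i)%Z.
Proof.
have cE n i : coord X i (sigma_loop xi sigma f n) =
  xi ^ (deg i - n) * coord X i (f n).
  rewrite -[sigma_loop _ _ _ n]/(xi ^ (- n) *:
    sigma (f n)) linearZ /= coord_sigma.
  by rewrite mulrA -(exprzDr xi_unit) addrC.
have dE n i : (m %| n - deg i)%Z = (xi ^ (deg i - n) == 1).
  by rewrite -(prim_root_dvdz _ xi_prim) -opprB !dvdzE abszN.
split=> [fE n i fn|fP].
  by have := cE n i; rewrite fE dE -{1}[coord X i _]mul1r => /(mulIf fn)<-.
apply: loopP => n; apply: (coord_inj Xbasis) => i; rewrite cE.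
have [->|/fP] := eqVneq (coord X i (f n)) 0; first by rewrite mulr0.
by rewrite dE => /eqP->; rewrite mul1r.
Qed.

Lemma regrade_fixed f : ptilde J f -> current_fixed xi sigma (regr f).
Proof.
move=> /(ptildeP D_root D_chevalley m_gt0 m_def) fP.
split; first exact/(nonneg_degreeP D_chevalley J m_gt0).
apply/sigma_loop_fixed => n i; rewrite (coord_regrade Xbasis).
by case: ifP; rewrite ?eqxx.
Qed.

Lemma ungrade_ptilde f : current_fixed xi sigma f ->
  ptilde J (ungrade X deg m_gt0 f).
Proof.
move=> [fc fs]; apply/(ptildeP D_root D_chevalley m_gt0 m_def) => i r.
by rewrite (coord_ungrade Xbasis) leNgt; apply: contra => /fc->;
  rewrite linear0.
Qed.

(** * The regrading map between the two subalgebras *)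

Fact regrade_sub_subproof (u : subLie (ptilde J)) :
  regr (subLie_val u) \in lieSubalg_pred (current_fixed xi sigma).
Proof. by apply/asboolP/regrade_fixed/asboolP; case: u. Qed.

Definition regrade_sub (u : subLie (ptilde J)) :
    subLie (current_fixed xi sigma) :=
  SubLie (regrade_sub_subproof u).

Fact regrade_sub_linear : linear regrade_sub.
Proof. move=> a u v; apply: val_inj; exact: (regrade_linear Xbasis). Qed.

Fact regrade_sub_lie u v : regrade_sub ⟦u, v⟧ = ⟦regrade_sub u, regrade_sub v⟧.
Proof.
apply: val_inj; rewrite /=.
exact: (regrade_bracket Xbasis m_gt0 (chev_deg_bracket D_root D_chevalley J)).
Qed.

HB.instance Definition _ := GRing.isLinear.Build K (subLie (ptilde J))
  (subLie (current_fixed xi sigma)) *:%R regrade_sub regrade_sub_linear.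
HB.instance Definition _ := isLieMorphism.Build K (subLie (ptilde J))
  (subLie (current_fixed xi sigma)) regrade_sub regrade_sub_lie.

Definition regrade_iso :
    lieHom (subLie (ptilde J)) (subLie (current_fixed xi sigma)) :=
  regrade_sub.

Lemma regrade_fin_homog c r (x : g) : homogeneous X (@chev_weight K g D) c x ->
  regr (mono r x) = mono (gr J (fin_to_aff c + imag_root D *~ r)) x.
Proof.
move=> xc; rewrite (gr_affine m_def); apply: (regrade_mono Xbasis) => //.
by move=> i /xc; rewrite /chev_deg => ->.
Qed.

Lemma regrades_iso : regrades regrade_iso.
Proof.
split=> [c r u /andP[rc _]|c r u /andP[rc _]|h r u hH] uE.
- by rewrite [LHS]/= uE (regrade_fin_homog _ (homog_root D_chevalley rc)).
- have rNc := rootsN D_root D_chevalley rc.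
  by rewrite [LHS]/= uE (regrade_fin_homog _ (homog_root D_chevalley rNc))
    fin_to_affN.
- rewrite [LHS]/= uE (regrade_fin_homog _ (homog_csa D_chevalley hH)).
  congr mono; congr gr; rewrite -[RHS]add0r; congr (_ + _).
  by apply/rowP=> i; rewrite !mxE; case: (unlift _ _) => [j|//]; rewrite mxE.
Qed.

Lemma ptilde_mono (i : I) r : 0 <= deg i + r * m%:Z -> ptilde J (mono r X`_i).
Proof.
move=> ir; apply/(ptildeP D_root D_chevalley m_gt0 m_def) => j s.
rewrite monoE; case: (s =P r) => [->|_]; last by rewrite linear0 eqxx.
by rewrite (coord_elem Xbasis); case: (i =P j) => [<-|_] //; rewrite eqxx.
Qed.

Lemma regrades_unique (psi psi' : {linear subLie (ptilde J) ->
  subLie (current_fixed xi sigma)}) :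
  regrades psi -> regrades psi' -> psi =1 psi'.
Proof.
move=> [p1 p2 p3] [q1 q2 q3] u.
(* Agreement is phrased as a subspace of the ambient loop algebra, so that it can be checked on the
   monomials occurring in the given element; these again have nonnegative degree and lie in
   [ptilde J]. *)
pose S (f : loop g) := exists2 v : subLie (ptilde J), subLie_val v =
  f & psi v = psi' v.
suff [v vu] : S (subLie_val u) by rewrite (val_inj vu).
have S_sub : is_subspace S.
  split=> [|a _ _ [v <- vE] [w <- wE]]; first by exists 0; rewrite ?linear0.
  by exists (a *: v + w); rewrite // !linearP vE wE.
apply: (loop_span Xbasis S_sub) => i r uir.
have fP : nonneg_degree J m (subLie_val u).
  by apply/(ptildeP D_root D_chevalley m_gt0 m_def)/asboolP; case: u {uir}.
have ip : mono r X`_i \in lieSubalg_pred (ptilde J).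
  by apply/asboolP/ptilde_mono; exact: fP.
exists (SubLie ip) => //; apply: val_inj.
have [j iE _|ri iE] := chevP i.
  have iH : X`_i \in H.
    by rewrite iE; apply: coroot_csa => //; exact: simple_in_roots.
  have vE : subLie_val (SubLie ip) = mono r X`_i by [].
  by rewrite [LHS](p3 _ _ _ iH vE) [RHS](q3 _ _ _ iH vE).
have /orP[pi|ni] := root_pos_or_neg D_root ri.
  have pr : pos_root (chev_weight i) by rewrite /pos_root ri.
  have vE : subLie_val (SubLie ip) = mono r (rvec (chev_weight i))
    by rewrite -iE.
  by rewrite [LHS](p1 _ _ _ pr vE) [RHS](q1 _ _ _ pr vE).
have pr : pos_root (- chev_weight i) by rewrite /pos_root ni rootsN.
have vE : subLie_val (SubLie ip) = mono r (rvec (- - chev_weight i))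
  by rewrite opprK -iE.
by rewrite [LHS](p2 _ _ _ pr vE) [RHS](q2 _ _ _ pr vE).
Qed.

Lemma regrade_iso_bij : bijective regrade_iso.
Proof.
have inj : injective regrade_iso.
  move=> u v uv; apply: val_inj; apply: (regrade_inj Xbasis (deg := deg) m_gt0).
  exact: (congr1 val uv).
have vP (v : subLie (current_fixed xi sigma)) :
    ungrade X deg m_gt0 (subLie_val v) \in lieSubalg_pred (ptilde J).
  by apply/asboolP/ungrade_ptilde/asboolP; case: v.
have surj v : regrade_iso (SubLie (vP v)) = v.
  apply: val_inj; apply: (ungradeK Xbasis).
  by apply/sigma_loop_fixed; case: v {vP} => f /= /asboolP[].
by exists (fun v => SubLie (vP v)) => // u; apply: inj; rewrite surj.
Qed.

(** A weight vector of weight a involves only t^(a_0) and basis vectors whose weight is the finite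
    part of a, so regrading sends it to the single power t^(gr a). Conversely, if only t^k survives,
    every monomial of f is a weight vector of degree k. *)
Lemma ptilde_degreeP k f : ptilde J f ->
  ptilde_degree J k f <-> t_degree k (regr f).
Proof.
move=> fp; split=> [|fk].
  move=> /(_ (fun h => t_degree k (regr h))); apply; split.
    split=> [r rk|a h h' hk h'k r rk].
      apply: (coord_inj Xbasis) => i.
      by rewrite (coord_regrade Xbasis) loop0E linear0 if_same.
    by rewrite (regrade_linear Xbasis) loopDE loopZE hk // h'k // scaler0 addr0.
  move=> h [_ [a ak ha]] r rk; apply: (coord_inj Xbasis) => i.
  rewrite (coord_regrade Xbasis) linear0; case: ifP => // mr.
  apply/eqP; apply: contraNT rk => /(loop_weight_coord D_root D_chevalley
    ha)[qE wE].
  by rewrite -ak (gr_fin_part m_def) -wE -qE divzK // addrC subrK.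
apply: (loop_span Xbasis); first exact: is_subspace_span.
move=> i r ir; have irk : deg i + r * m%:Z = k.
  apply/eqP; apply: contraNT ir => irk.
  by rewrite -(coord_regrade_deg Xbasis deg m_gt0) fk // linear0.
apply: sub_gen_smallest; split.
  by apply: ptilde_mono; apply: (ptildeP D_root D_chevalley m_gt0 m_def f).1 ir.
exists (fin_to_aff (chev_weight i) + imag_root D *~ r); first
  by rewrite (gr_affine m_def).
exact: loop_weight_mono.
Qed.

Lemma regrade_iso_graded : is_graded regrade_iso.
Proof. by move=> k u; apply/ptilde_degreeP/asboolP; case: u. Qed.

End Isomorphism.
Theorem proposition3p4 (R : realType) (g : finLieAlgType R[i])
    (D : cartanDatum g)
    (g_simple : is_simple g) (D_root : is_root_datum D)
    (D_chevalley : is_chevalley_basis D)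
    (J : {set 'I_(rank D).+1}) (J_proper : exists i, i \notin J)
    (m : nat) (m_def : m%:Z = gr J (imag_root D))
    (xi : R[i]) (xi_prim : m.-primitive_root xi)
    (sigma : lieHom g g) (sigma_def : is_kac_automorphism J m xi sigma) :
  exists phi : lieHom (subLie (ptilde J)) (subLie (current_fixed xi sigma)),
    [/\ regrades phi,
        forall psi : {linear subLie (ptilde J) ->
                             subLie (current_fixed xi sigma)},
          regrades psi -> psi =1 phi,
        bijective phi &
        is_graded phi].
Proof.
have [_ _ sigma_simple sigma_theta] := sigma_def.
exists (regrade_iso D_root D_chevalley m_def xi_prim sigma_simple sigma_theta).
split; [exact: regrades_iso | | exact: regrade_iso_bij | exact: regrade_iso_graded].
move=> psi psiR.
exact: (regrades_unique D_root D_chevalley m_def xi_prim psiR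
          (regrades_iso _ _ _ _ _ _)).
Qed.
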